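(* Let $d$ be a positive integer, $U\subseteq\mathbb R$ an open interval and $f:U\to\mathbb R$ a function with $2d+1$ derivatives. Suppose $Df(x)>0$ for all $x\in U$. Then the following are equivalent: (i) for all $1\le k\le d$ and all $x\in U$, $S_k(f)(x)$ exists and $S_k(f)(x)\ge 0$; (ii) $f$ is matrix monotone of order $d+1$.
   Context: $D$ denotes differentiation. Padé approximants and Schwarzian derivatives: a rational map is a quotient $p/q$ of polynomials with $q \not\equiv 0$; its degree is $\max(\deg p,\deg q)$ when $p,q$ are relatively prime. Let $k \ge 0$ be an integer and $g$ a real-valued function which is $2k$ times differentiable at a real point $y$. The $k$'th Padé approximant to $g$ at $y$, denoted $[g]_y^k$, is the rational map $\mathcal R$ of degree at most $k$ (finite at $y$) with $D^j\mathcal R(y) = D^j g(y)$ for $0 \le j \le 2k$, if such a map exists (it is then unique). If moreover $g$ is $2k+1$ times differentiable at $y$, $Dg(y) \ne 0$, $k\ge 1$, and $\mathcal R = [g]_y^k$ exists, the Schwarzian derivative of order $k$ is $S_k(g)(y) = D^{2k+1}(\mathcal R^{-1}\circ g)(y)$, where $\mathcal R^{-1}$ is the local inverse of $\mathcal R$ sending $g(y)$ to $y$; equivalently $S_k(g)(y) = D^{2k+1}(g-\mathcal R)(y)/Dg(y)$. We say $S_k(g)(y)$ exists when $[g]_y^k$ exists. Matrix monotone functions: for real symmetric $n\times n$ matrices, $A\le B$ means $B-A$ is positive semi-definite. For a real symmetric matrix $A$ with spectrum contained in $U$, $f(A)$ is defined by functional calculus (diagonalise $A$ orthogonally, apply $f$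 to the eigenvalues, undo the diagonalisation). A function $f:U\to\mathbb R$ is matrix monotone of order $n$ if for any real symmetric $n\times n$ matrices $A$ and $B$ with spectrum contained in $U$, $A\le B$ implies $f(A)\le f(B)$. *)

(* Defs.v *)
From mathcomp Require Export all_boot all_order all_algebra.
From mathcomp Require Export all_classical all_reals all_analysis.
Export Order.TTheory GRing.Theory Num.Theory.
Export numFieldNormedType.Exports.

#[export] Set Implicit Arguments.
#[export] Unset Strict Implicit.
#[export] Unset Printing Implicit Defensive.

Local Open Scope ring_scope.
Local Open Scope classical_set_scope.

(** Functions [U -> R] on an open set [U] are represented by total functions
    [R -> R] whose values outside [U] are irrelevant; [g^`(j)] (= [derive1n])
    at a point of [U] only depends on the values of [g] on [U]. *)
Definition nderivable_on (R : realType) (U : set R) (n : nat) (f : R -> R) :=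
  forall j : nat, (j < n)%N -> forall x, U x -> derivable f^`(j) x 1.

(** A rational map in lowest terms; the two polynomials are unique up to a
    common nonzero scalar factor. *)
Record ratmap (R : fieldType) := RatMap {
  rm_num : {poly R};
  rm_den : {poly R};
  rm_den_neq0 : rm_den != 0;
  rm_coprime : coprimep rm_num rm_den }.

(* [size p] is [deg p + 1] for [p != 0]; the zero map gets degree 0. *)
Definition rm_degree (R : fieldType) (r : ratmap R) : nat :=
  (maxn (size (rm_num r)) (size (rm_den r))).-1.

(* The value at a pole is the junk value [0]. *)
Definition rm_eval (R : fieldType) (r : ratmap R) (x : R) : R :=
  (rm_num r).[x] / (rm_den r).[x].
Coercion rm_eval : ratmap >-> Funclass.

(** [r] is the Pade approximant [g]_y^k; meaningful when [g] is [2k] times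
    differentiable at [y]. *)
Definition is_pade (R : realType) (k : nat) (g : R -> R) (y : R)
    (r : ratmap R) : Prop :=
  [/\ (rm_degree r <= k)%N,
      (rm_den r).[y] != 0 &
      forall j : nat, (j <= 2 * k)%N -> (r : R -> R)^`(j) y = g^`(j) y].

(* The first condition at [x = y] gives [h (r y) = y]. *)
Definition is_local_inverse (R : realType) (r : R -> R) (y : R)
    (h : R -> R) : Prop :=
  (\forall x \near y, h (r x) = x) /\ (\forall z \near r y, r (h z) = z).

Definition is_schwarzian (R : realType) (k : nat) (g : R -> R) (y s : R)
    : Prop :=
  exists (r : ratmap R) (h : R -> R),
    [/\ is_pade k g y r, is_local_inverse r y h &
        s = (h \o g)^`((2 * k).+1) y].

(** The Schwarzian derivative S_k(g)(y), for [g] that is [2k+1] times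
    differentiable at [y] with nonzero derivative there, and [k >= 1]; then
    [schwarzian_exists k g y] provides exactly one [s] with
    [is_schwarzian k g y s].  The junk value is [0] if there is none. *)
Definition schwarzian_exists (R : realType) (k : nat) (g : R -> R) (y : R)
    : Prop :=
  exists r : ratmap R, is_pade k g y r.

Definition schwarzian (R : realType) (k : nat) (g : R -> R) (y : R) : R :=
  xget 0 [set s | is_schwarzian k g y s].

Definition psdmx (R : realType) (n : nat) (A : 'M[R]_n) : Prop :=
  A^T = A /\ forall v : 'cV[R]_n, 0 <= (v^T *m A *m v) 0 0.

Definition loewner_le (R : realType) (n : nat) (A B : 'M[R]_n) : Prop :=
  psdmx (B - A).

(* For real symmetric [A] all complex eigenvalues are real, so [eigenvalue]
   captures the whole spectrum. *)
Definition spectrum_in (R : realType) (U : set R) (n : nat) (A : 'M[R]_n)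
    : Prop :=
  forall a : R, eigenvalue A a -> U a.

Definition is_mxfun (R : realType) (f : R -> R) (n : nat) (A B : 'M[R]_n)
    : Prop :=
  exists (P : 'M[R]_n) (d : 'rV[R]_n),
    [/\ P *m P^T = 1%:M, A = P^T *m diag_mx d *m P &
        B = P^T *m diag_mx (map_mx f d) *m P].

(** [f(A)] by functional calculus; for symmetric [A] there is exactly one [B]
    with [is_mxfun f A B], whatever diagonalisation is used. *)
Definition mxfun (R : realType) (f : R -> R) (n : nat) (A : 'M[R]_n)
    : 'M[R]_n :=
  xget 0 [set B | is_mxfun f A B].

Definition mx_monotone (R : realType) (U : set R) (n : nat) (f : R -> R)
    : Prop :=
  forall A B : 'M[R]_n, A^T = A -> B^T = B ->
    spectrum_in U A -> spectrum_in U B ->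
    loewner_le A B -> loewner_le (mxfun f A) (mxfun f B).

(* Main.v *)
From mathcomp Require Import complex ring lra zify.
Require Import Defs.
Local Open Scope ring_scope.
Local Open Scope classical_set_scope.

(** Both conditions say that at every point [y] of [U] the Hankel matrix of the
    Taylor coefficients [F_(i+j+1)] ([0 <= i, j <= d]) of [f] at [y] is positive
    semi-definite, i.e. that the coefficient of [X^(2d+1)] in [p^2 F] is
    nonnegative for every polynomial [p] of degree at most [d].

    Pointwise, let [p/q] be the [k]th Pade approximant.  The coefficient of
    [X^(2k+1)] in [F q - p] equals [S_k] up to positive factors and [q(0)], and
    splitting [P = a q + X p1] diagonalises one more step of the Hankel form:
    its value at [P] is [a^2] times a positive multiple of [S_k] plus the value
    at [p1] of the form of size one less.

    For [B = A + v v^T], the resolvent identity writes [x^T (f(B) - f(A)) x] as a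
    sum of values of [f] at the eigenvalues of [A] and [B] whose partial fraction
    is a square [P^2] over the product of the two characteristic polynomials.
    This is a divided difference of [P^2 f], hence a Hankel form at some point of
    [U] by Rolle's theorem.  Conversely, scaling one fixed rank one pair [A <= B]
    towards [y] recovers every Hankel form at [y] in the limit. *)

(** * Spectral theorem for real symmetric matrices *)

(** Only [2d+1] derivatives are given and the top one may be discontinuous, so integral formulas for
    divided differences are out of reach: sufficiency uses zeros and Rolle only, necessity a Taylor
    formula with Peano remainder. A general [A <= B] reduces to rank one because [B - A] is a sum of
    outer products. The intermediate spectra stay in [U]: each of their eigenvalues lies between one
    of [A] and one of [B], and [U] is an interval. Eigenvalues of [A] and [B] may coincide, and a
    divided difference would then involve derivatives of [f]. A repeated node is first cancelled
    against the square [P^2], which leaves distinct nodes. In the converse the matrices are fixed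
    and the test vector carries the polynomial: Lagrange interpolation makes the square equal to
    [p(tX)^2]. Existence of the approximants cannot rely on an invertible Hankel form, which may be
    singular. Semi-definiteness replaces it: an isotropic vector lies in the kernel. Positivity of
    [f'] starts the induction on [k], makes the approximants locally invertible and gives the
    conversion factors their sign. *)

Lemma sym_eigenvalue (R : rcfType) n (A : 'M[R]_n.+1) :
  A^T = A -> exists a, eigenvalue A a.
Proof.
move=> symA; pose phi : {rmorphism R -> complex R} := real_complex R.
pose B := map_mx phi A.
have Bherm : B \is (hermitianmx n.+1 false Num.conj).
  apply: realsym_hermsym.
    by apply/is_hermitianmxP; rewrite expr0 scale1r [RHS]map_mx_id // /B map_trmx symA.
  by apply/mxOverP => i j; rewrite mxE; apply/complex_realP; exists (A i j).
have := mxOverP (hermitian_spectral_diag_real Bherm) 0 0.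
move=> /complex_realP [a Da].
have /hermitian_normalmx /orthomx_spectralP EB := Bherm.
set P := spectralmx B in EB.
have uP : P \in unitmx by exact: spectral_unit.
(* The diagonal entry [a] is real, so being a root of the characteristic polynomial descends from
   the complex numbers. *)
exists a; rewrite eigenvalue_root_char -(fmorph_root phi) /= map_char_poly.
rewrite -eigenvalue_root_char; apply/eigenvalueP; exists (row 0 P).
  rewrite -/B EB -!row_mul !mulmxA mulmxV // mul1mx row_mul row_diag_mx Da.
  by rewrite -scalemxAl -rowE.
apply/eqP => P0; have := mulmxV uP => /(congr1 (row 0)).
by rewrite row_mul P0 mul0mx => /rowP /(_ 0) /eqP; rewrite !mxE eqxx eq_sym oner_eq0.
Qed.

(** The matrix is the reflection along [u - e], whose squared length [2 - 2 * (u *m e^T) 0 0] has to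
    be invertible. *)
Lemma householder_row (R : fieldType) n (u e : 'rV[R]_n) :
  u *m u^T = 1%:M -> e *m e^T = 1%:M -> (2 - 2 * (u *m e^T) 0 0 != 0) ->
  exists P : 'M[R]_n, P *m P^T = 1%:M /\ e *m P = u.
Proof.
move=> uu ee ue; set c := (u *m e^T) 0 0 in ue.
have ueE : u *m e^T = c%:M by rewrite [LHS]mx11_scalar.
have euE : e *m u^T = c%:M by rewrite -[LHS]trmxK trmx_mul trmxK ueE tr_scalar_mx.
pose w := u - e; pose k := 2 / (2 - 2 * c).
have ww : w *m w^T = (2 - 2 * c)%:M.
  rewrite linearB /= mulmxBl !mulmxBr uu ee ueE euE -!raddfB /=; congr _%:M; ring.
have ew : e *m w^T = (c - 1)%:M by rewrite linearB /= mulmxBr ee euE -raddfB.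
exists (1%:M - k *: (w^T *m w)); split; last first.
  rewrite mulmxBr mulmx1 -scalemxAr mulmxA ew mul_scalar_mx scalerA.
  have -> : k * (c - 1) = - 1 by rewrite /k; field.
  by rewrite scaleN1r opprK addrC subrK.
have -> : (1%:M - k *: (w^T *m w))^T = 1%:M - k *: (w^T *m w).
  by rewrite linearB /= linearZ /= trmx1 trmx_mul trmxK.
rewrite mulmxBr mulmx1 mulmxBl mul1mx -scalemxAr -scalemxAl.
rewrite mulmxA -(mulmxA w^T) ww -mulmxA mul_scalar_mx -scalemxAr !scalerA.
have -> : k * k * (2 - 2 * c) = k + k by rewrite /k; field.
by rewrite scalerDl opprB addrK subrK.
Qed.

Lemma row_normE (R : pzRingType) n (v : 'rV[R]_n) :
  (v *m v^T) 0 0 = \sum_i v 0 i ^+ 2.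
Proof. by rewrite mxE; apply: eq_bigr => i _; rewrite mxE expr2. Qed.

Lemma row_norm_ge0 (R : realDomainType) n (v : 'rV[R]_n) : 0 <= (v *m v^T) 0 0.
Proof. by rewrite row_normE sumr_ge0 // => i _; rewrite sqr_ge0. Qed.

Lemma row_norm_eq0 (R : realDomainType) n (v : 'rV[R]_n) :
  ((v *m v^T) 0 0 == 0) = (v == 0).
Proof.
apply/idP/eqP => [|->]; last by rewrite mul0mx mxE.
rewrite row_normE psumr_eq0 => [/allP Z|j _]; last exact: sqr_ge0.
apply/rowP => i; have := Z i (mem_index_enum _).
by rewrite sqrf_eq0 => /eqP ->; rewrite mxE.
Qed.

Lemma orthogonal_with_first_row (R : realFieldType) n (u : 'rV[R]_n.+1) :
  u *m u^T = 1%:M ->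
  exists P : 'M[R]_n.+1, P *m P^T = 1%:M /\ row 0 P = u.
Proof.
move=> uu; pose e : 'rV[R]_n.+1 := delta_mx 0 0.
have ee : e *m e^T = 1%:M.
  by apply/matrixP => i j; rewrite trmx_delta mul_delta_mx !mxE !ord1 !eqxx.
(* The reflection degenerates exactly when [u] is already the first basis vector; the identity
   serves there. *)
have [ue|ue] := boolP (2 - 2 * (u *m e^T) 0 0 == 0); last first.
  have [P [PP eP]] := householder_row uu ee ue.
  by exists P; split; rewrite // rowE.
have c1 : u *m e^T = 1%:M.
  rewrite [LHS]mx11_scalar; congr _%:M; move: ue; rewrite subr_eq0 => /eqP E.
  by apply: (@mulfI _ 2); rewrite ?pnatr_eq0 // -E mulr1.
have eu1 : e *m u^T = 1%:M by rewrite -[LHS]trmxK trmx_mul trmxK c1 tr_scalar_mx.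
exists 1%:M; rewrite trmx1 mulmx1; split => //.
have w0 : (u - e) *m (u - e)^T = 0.
  by rewrite linearB /= mulmxBl !mulmxBr uu ee c1 eu1 !subrr.
have /eqP : u - e == 0 by rewrite -row_norm_eq0 w0 mxE.
by move/eqP; rewrite subr_eq0 => /eqP ->; rewrite row1.
Qed.

Lemma sym_spectral (R : rcfType) n (A : 'M[R]_n) : A^T = A ->
  exists (P : 'M[R]_n) (d : 'rV[R]_n),
    P *m P^T = 1%:M /\ A = P^T *m diag_mx d *m P.
Proof.
elim: n A => [|n IH] A symA.
  by exists 1%:M, 0; split; apply/matrixP => -[].
have [a /eigenvalueP [v vA v0]] := sym_eigenvalue symA.
have vv : 0 < (v *m v^T) 0 0.
  by rewrite lt_neqAle eq_sym row_norm_eq0 v0 row_norm_ge0.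
pose s := Num.sqrt ((v *m v^T) 0 0); have s0 : s != 0 by rewrite gt_eqF // sqrtr_gt0.
pose u := s^-1 *: v.
have uu : u *m u^T = 1%:M.
  rewrite linearZ /= -scalemxAl -scalemxAr scalerA [v *m _]mx11_scalar.
  rewrite -[(v *m v^T) 0 0]sqr_sqrtr ?ltW // -/s -mul_scalar_mx -scalar_mxM.
  by congr _%:M; field.
have uA : u *m A = a *: u by rewrite -scalemxAl vA !scalerA mulrC.
have [P [PP rP]] := orthogonal_with_first_row uu.
have PTP : P^T *m P = 1%:M by apply: mulmx1C.
(* Deflation: the first row of [M] is [a] times a basis vector, symmetry clears the first column,
   and a symmetric block of size [n] remains. *)
pose M : 'M[R]_(1 + n) := P *m A *m P^T.
have symM : M^T = M by rewrite /M !trmx_mul trmxK symA mulmxA.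
have rM : row 0 M = a *: delta_mx 0 0.
  by rewrite /M !row_mul rP uA -scalemxAl -rP -row_mul PP row1.
have M1 : usubmx M = a *: delta_mx 0 0.
  rewrite -rM; apply/matrixP => i j; rewrite ord1 [LHS]mxE [RHS]mxE.
  by congr (M _ _); exact: val_inj.
have Mul : ulsubmx M = a%:M.
  by apply/matrixP => i j; rewrite !ord1 /ulsubmx M1 !mxE !eqxx mulr1 mulr1n.
have Mur : ursubmx M = 0.
  apply/matrixP => i j; rewrite !ord1 /ursubmx M1 !mxE -(inj_eq val_inj) /= mulr0 //.
have Mdl : dlsubmx M = 0.
  by rewrite -[LHS]trmxK trmx_dlsub symM Mur trmx0.
have [Q [d [QQ DQ]]] := IH (drsubmx M) (etrans (trmx_drsub _) (congr1 _ symM)).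
pose Q' : 'M[R]_(1 + n) := block_mx 1%:M 0 0 Q.
have Q'T : Q'^T = block_mx 1%:M 0 0 Q^T by rewrite tr_block_mx !trmx0 trmx1.
have QQ' : Q' *m Q'^T = 1%:M.
  rewrite Q'T /Q' mulmx_block QQ !(mulmx0, mul0mx, mul1mx, addr0, add0r).
  by rewrite -scalar_mx_block.
exists (Q' *m P), (row_mx a%:M d : 'rV_(1 + n)); split.
  by rewrite trmx_mul mulmxA -(mulmxA Q') PP mulmx1; exact: QQ'.
have MB : M = Q'^T *m diag_mx (row_mx a%:M d : 'rV_(1 + n)) *m Q'.
  rewrite -[LHS]submxK Mul Mur Mdl DQ diag_mx_row Q'T /Q' !mulmx_block.
  rewrite !(mulmx0, mul0mx, mul1mx, mulmx1, addr0, add0r); congr block_mx.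
  by apply/matrixP => i j; rewrite !ord1 !mxE eqxx mulr1n.
rewrite trmx_mul !mulmxA -2!(mulmxA P^T) -MB /M !mulmxA PTP mul1mx.
by rewrite -mulmxA PTP mulmx1.
Qed.

(** * Rank one perturbations *)

(** The block matrix with rows [(1, -w)] and [(u, 1)] factors into block-triangular matrices in two
    orders; the two determinants are compared. *)
Lemma det_add_rank1 (R : comNzRingType) n (u : 'cV[R]_n) (w : 'rV[R]_n) :
  \det (1%:M + u *m w) = 1 + (w *m u) 0 0.
Proof.
have E : block_mx 1%:M 0 u 1%:M *m block_mx 1%:M (- w) 0 (1%:M + u *m w)
       = block_mx 1%:M (- w) 0 1%:M *m block_mx (1%:M + w *m u) 0 u 1%:M.
  rewrite !mulmx_block !(mulmx0, mul0mx, mul1mx, mulmx1, addr0, add0r).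
  by rewrite mulmxN mulNmx addrK addrCA addNr addr0.
move/(congr1 determinant): E; rewrite !det_mulmx det_lblock !det_ublock det_lblock.
rewrite !det1 !mul1r mulr1 => ->.
by rewrite {1}[w *m u]mx11_scalar -raddfD /= det_scalar expr1.
Qed.

(** [(p - q) * r] vanishes everywhere, hence at more natural numbers than its degree allows. This
    turns rational identities into polynomial ones. *)
Lemma poly_eq_off_roots (R : numDomainType) (p q r : {poly R}) : r != 0 ->
  (forall z, r.[z] != 0 -> p.[z] = q.[z]) -> p = q.
Proof.
move=> r0 pq; apply/eqP; rewrite -subr_eq0; apply: contraT => d0.
have h0 : (p - q) * r != 0 by rewrite mulf_neq0.
have := @max_poly_roots _ _ [seq i%:R | i <- iota 0 (size ((p - q) * r))] h0.
rewrite size_map size_iota ltnn => H; apply: H; last first.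
  by rewrite map_inj_uniq ?iota_uniq //; exact: mulrIn (oner_neq0 _).
apply/allP => z _; rewrite /root hornerM; have [->|rz] := eqVneq r.[z] 0.
  by rewrite mulr0.
by rewrite !hornerE pq // subrr mul0r.
Qed.

Lemma quad_diag (R : comPzRingType) n (P : 'M[R]_n) (d : 'rV[R]_n) (x y : 'cV[R]_n) :
  (x^T *m (P^T *m diag_mx d *m P) *m y) 0 0
  = \sum_i (P *m x) i 0 * d 0 i * (P *m y) i 0.
Proof.
rewrite !mulmxA -trmx_mul -mulmxA mxE; apply: eq_bigr => i _.
by rewrite mul_mx_diag !mxE.
Qed.

Definition resolvent (R : fieldType) n (S : 'M[R]_n) (d : 'rV[R]_n) (z : R) :=
  S^T *m diag_mx (map_mx (fun t => (z - t)^-1) d) *m S.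

Section RankOne.
Variables (R : numFieldType) (n : nat) (P Q : 'M[R]_n) (a b : 'rV[R]_n).
Variables (c : R) (v : 'cV[R]_n).
Hypotheses (PP : P *m P^T = 1%:M) (QQ : Q *m Q^T = 1%:M).
Hypothesis BA :
  Q^T *m diag_mx b *m Q = P^T *m diag_mx a *m P + c *: (v *m v^T).

Lemma conj_diag_sub (S : 'M[R]_n) (d : 'rV[R]_n) (z : R) : S *m S^T = 1%:M ->
  z%:M - S^T *m diag_mx d *m S
  = S^T *m diag_mx (map_mx (fun t => z - t) d) *m S.
Proof.
move=> SS; rewrite (_ : diag_mx (map_mx _ d) = z%:M - diag_mx d).
  by rewrite mulmxBr mulmxBl mul_mx_scalar -scalemxAl (mulmx1C SS) scalemx1.
by apply/matrixP => i j; rewrite !mxE mulrnBl.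
Qed.

Lemma conj_diag_resolvent (S : 'M[R]_n) (d : 'rV[R]_n) (z : R) :
  S *m S^T = 1%:M -> (forall i, z != d 0 i) ->
  (z%:M - S^T *m diag_mx d *m S) *m resolvent S d z = 1%:M.
Proof.
move=> SS zd; have STS := mulmx1C SS.
rewrite conj_diag_sub //.
rewrite /resolvent !mulmxA -(mulmxA _ S) SS mulmx1 -(mulmxA S^T) mulmx_diag.
rewrite -STS; congr (_ *m S); rewrite -[RHS]mulmx1; congr (_ *m _).
apply/matrixP => i j; rewrite !mxE mulfV ?subr_eq0 ?zd //.
Qed.

Lemma det_conj_diag (S : 'M[R]_n) (d : 'rV[R]_n) (z : R) :
  S *m S^T = 1%:M -> \det (z%:M - S^T *m diag_mx d *m S) = \prod_i (z - d 0 i).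
Proof.
move=> SS; have STS := mulmx1C SS.
rewrite conj_diag_sub //.
rewrite !det_mulmx mulrAC -det_mulmx STS det1 mul1r det_diag.
by apply: eq_bigr => i _; rewrite !mxE.
Qed.

Let A := P^T *m diag_mx a *m P.
Let B := Q^T *m diag_mx b *m Q.

(** The difference of the resolvents [GB - GA] has rank one. Writing it in both orders turns
    [GB *m v] into [GA *m v] times a scalar, and by the determinant lemma this scalar is the
    quotient of the two characteristic polynomials; what is left is a square. *)
Lemma resolvent_rank1 (x : 'cV[R]_n) (z : R) :
  (forall i, z != a 0 i) -> (forall i, z != b 0 i) ->
  \prod_i (z - b 0 i) * ((x^T *m resolvent Q b z *m x) 0 0
                          - (x^T *m resolvent P a z *m x) 0 0)
  = \prod_i (z - a 0 i) * c * (x^T *m resolvent P a z *m v) 0 0 ^+ 2.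
Proof.
move=> za zb; move GAE: (resolvent P a z) => GA; move GBE: (resolvent Q b z) => GB.
have AGA : (z%:M - A) *m GA = 1%:M by rewrite -GAE; apply: conj_diag_resolvent.
have BGB : (z%:M - B) *m GB = 1%:M by rewrite -GBE; apply: conj_diag_resolvent.
have GAA := mulmx1C AGA; have GBB := mulmx1C BGB.
have AB : (z%:M - A) - (z%:M - B) = c *: (v *m v^T).
  by rewrite opprB addrC addrA subrK /A /B BA addrAC subrr add0r.
have symG S d : (resolvent S d z)^T = resolvent S d z.
  by rewrite /resolvent !trmx_mul trmxK tr_diag_mx mulmxA.
have GBA : GB - GA = GB *m (c *: (v *m v^T)) *m GA.
  by rewrite -AB mulmxBr mulmxBl -mulmxA AGA mulmx1 GBB mul1mx.
have GAB : GB - GA = GA *m (c *: (v *m v^T)) *m GB.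
  by rewrite -AB mulmxBr mulmxBl GAA mul1mx -mulmxA BGB mulmx1.
have form (G H : 'M[R]_n) (y w : 'cV_n) :
    (y^T *m (G *m (c *: (v *m v^T)) *m H) *m w) 0 0
    = c * (y^T *m G *m v) 0 0 * (v^T *m H *m w) 0 0.
  rewrite -scalemxAr -!scalemxAl -scalemxAr -scalemxAl mxE -mulrA; congr (_ * _).
  rewrite !mulmxA -[y^T *m G *m v *m v^T *m H *m w]mulmxA -!mulmxA mulmxA.
  by rewrite mulmxA mxE big_ord1 !mulmxA.
have detAB : \prod_i (z - a 0 i)
    = \prod_i (z - b 0 i) * (1 + c * (v^T *m GB *m v) 0 0).
  rewrite -(det_conj_diag _ _ PP) -(det_conj_diag _ _ QQ) -/A -/B.
  have -> : z%:M - A = (z%:M - B) *m (1%:M + (GB *m v) *m (c *: v^T)).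
    rewrite mulmxDr mulmx1 (mulmxA _ (GB *m v)) (mulmxA _ GB) BGB mul1mx -scalemxAr -AB.
    by rewrite [RHS]addrC subrK.
  by rewrite det_mulmx det_add_rank1 -scalemxAl mulmxA mxE.
have -> : (x^T *m GB *m x) 0 0 - (x^T *m GA *m x) 0 0
   = c * (x^T *m GB *m v) 0 0 * (v^T *m GA *m x) 0 0.
  rewrite -form -GBA mulmxBr mulmxBl [RHS]mxE; congr (_ + _).
  by rewrite [RHS]mxE.
have -> : (x^T *m GB *m v) 0 0
    = (x^T *m GA *m v) 0 0 * (1 + c * (v^T *m GB *m v) 0 0).
  rewrite mulrDr mulr1 [_ * (c * _)]mulrCA mulrA -form -GAB mulmxBr mulmxBl.
  by rewrite [X in _ = _ + X]mxE [X in _ = _ + (_ + X)]mxE addrC subrK.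
have -> : (v^T *m GA *m x) 0 0 = (x^T *m GA *m v) 0 0.
  by rewrite -[v^T *m GA *m x]trmxK mxE !trmx_mul trmxK -GAE symG mulmxA.
by rewrite detAB; ring.
Qed.

Lemma resolvent_quad (S : 'M[R]_n) (d : 'rV[R]_n) (x y : 'cV[R]_n) (z : R) :
  (forall i, z != d 0 i) ->
  \prod_i (z - d 0 i) * (x^T *m resolvent S d z *m y) 0 0
  = (\sum_i ((S *m x) i 0 * (S *m y) i 0) *:
        \prod_(l | l != i) ('X - (d 0 l)%:P)).[z].
Proof.
move=> zd; rewrite /resolvent quad_diag mulr_sumr horner_sum; apply: eq_bigr => i _.
rewrite hornerZ horner_prod (bigD1 i) //= [map_mx _ _ _ _]mxE.
under [in RHS]eq_bigr do rewrite hornerXsubC.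
by field; rewrite subr_eq0 zd.
Qed.

Lemma rank1_form (x : 'cV[R]_n) :
  \prod_i ('X - (a 0 i)%:P) *
    (\sum_i ((Q *m x) i 0 * (Q *m x) i 0) *: \prod_(l | l != i) ('X - (b 0 l)%:P))
  - \prod_i ('X - (b 0 i)%:P) *
    (\sum_i ((P *m x) i 0 * (P *m x) i 0) *: \prod_(l | l != i) ('X - (a 0 l)%:P))
  = c *: (\sum_i ((P *m x) i 0 * (P *m v) i 0) *:
            \prod_(l | l != i) ('X - (a 0 l)%:P)) ^+ 2.
Proof.
pose pi (d : 'rV[R]_n) : {poly R} := \prod_i ('X - (d 0 i)%:P).
have piE d z : (pi d).[z] = \prod_i (z - d 0 i).
  by rewrite horner_prod; apply: eq_bigr => i _; rewrite hornerXsubC.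
apply: (@poly_eq_off_roots _ _ _ (pi a * pi b)).
  by rewrite mulf_neq0 //; apply/prodf_neq0 => i _; rewrite polyXsubC_eq0.
move=> z; rewrite hornerM mulf_eq0 negb_or => /andP[za0 zb0].
have neq d : (pi d).[z] != 0 -> forall i, z != d 0 i.
  by rewrite piE => /prodf_neq0 H i; rewrite -subr_eq0 H.
have za := neq _ za0; have zb := neq _ zb0.
rewrite hornerD hornerN !hornerM -/(pi a) -/(pi b) hornerZ horner_exp.
rewrite -(resolvent_quad _ _ _ za) -(resolvent_quad _ _ _ za) -(resolvent_quad _ _ _ zb) !piE.
have := resolvent_rank1 x za zb; set pb := \prod_i (z - b 0 i).
set pa := \prod_i (z - a 0 i) => E.
rewrite exprMn; transitivity (pa * (pb * ((x^T *m resolvent Q b z *m x) 0 0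
                          - (x^T *m resolvent P a z *m x) 0 0))); first by ring.
by rewrite E; ring.
Qed.

End RankOne.

(** * Weighted sums over nodes *)

Section WeightedNodes.
Variable R : fieldType.
Implicit Types (L : seq (R * R)) (f g : R -> R) (P : {poly R}).

Definition node_poly L : {poly R} := \prod_(x <- L) ('X - x.1%:P).

(* [weight_poly L / node_poly L] is the partial fraction [\sum c / ('X - s)]
   over the pairs [(s, c)] of [L]; the nodes [s] may be repeated. *)
Definition weight_poly L : {poly R} :=
  \sum_(x <- L) x.2 *: (node_poly L %/ ('X - x.1%:P)).

Definition weighted_sum L g : R := \sum_(x <- L) x.2 * g x.1.

Lemma node_poly_cons x L : node_poly (x :: L) = ('X - x.1%:P) * node_poly L.
Proof. exact: big_cons. Qed.

Lemma size_node_poly L : size (node_poly L) = (size L).+1.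
Proof.
rewrite /node_poly -(big_map fst xpredT (fun s => 'X - s%:P)).
by rewrite size_prod_XsubC size_map.
Qed.

Lemma monic_node_poly L : node_poly L \is monic.
Proof. exact: monic_prod_XsubC. Qed.

Lemma root_node_poly L s : root (node_poly L) s = (s \in map fst L).
Proof.
rewrite /node_poly -(big_map fst xpredT (fun s => 'X - s%:P)).
exact: root_prod_XsubC.
Qed.

Lemma node_poly_divK L x : x \in L ->
  node_poly L %/ ('X - x.1%:P) * ('X - x.1%:P) = node_poly L.
Proof.
move=> xL; apply: divpK; rewrite dvdp_XsubCl root_node_poly.
exact: (map_f fst).
Qed.

Lemma coef_node_poly_div L x : x \in L ->
  (node_poly L %/ ('X - x.1%:P))`_(size L).-1 = 1.
Proof.
move=> xL; have : lead_coef (node_poly L %/ ('X - x.1%:P)) = 1.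
  have := monic_node_poly L; rewrite -{1}(node_poly_divK xL) monicMr ?monicXsubC //.
  by move/monicP.
by rewrite lead_coefE size_divp ?polyXsubC_eq0 // size_XsubC subn1 size_node_poly.
Qed.

Lemma weight_poly_cons x L :
  weight_poly (x :: L) = x.2 *: node_poly L + ('X - x.1%:P) * weight_poly L.
Proof.
rewrite /weight_poly big_cons node_poly_cons mulKp ?polyXsubC_eq0 //.
congr (_ + _); rewrite mulr_sumr big_seq [RHS]big_seq; apply: eq_bigr => y yL.
rewrite -scalerAr; congr (_ *: _).
by rewrite -{1}(node_poly_divK yL) mulrA mulpK ?polyXsubC_eq0.
Qed.

Lemma perm_node_poly L L' : perm_eq L L' -> node_poly L = node_poly L'.
Proof. exact: perm_big. Qed.

Lemma perm_weight_poly L L' : perm_eq L L' -> weight_poly L = weight_poly L'.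
Proof.
by move=> LL'; rewrite /weight_poly (perm_big _ LL') (perm_node_poly LL').
Qed.

Lemma perm_weighted_sum L L' g : perm_eq L L' ->
  weighted_sum L g = weighted_sum L' g.
Proof. exact: perm_big. Qed.

Lemma weighted_sum_cons x L g :
  weighted_sum (x :: L) g = x.2 * g x.1 + weighted_sum L g.
Proof. exact: big_cons. Qed.

Lemma node_poly_cat L1 L2 : node_poly (L1 ++ L2) = node_poly L1 * node_poly L2.
Proof. exact: big_cat. Qed.

Lemma weight_poly_cat L1 L2 : weight_poly (L1 ++ L2) =
  node_poly L2 * weight_poly L1 + node_poly L1 * weight_poly L2.
Proof.
elim: L1 => [|x L1 IH].
  by rewrite /weight_poly [X in _ * X + _]big_nil mulr0 add0r /node_poly big_nil mul1r.
rewrite cat_cons !weight_poly_cons IH node_poly_cat node_poly_cons.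
by rewrite -!mul_polyC; ring.
Qed.

Lemma node_poly_ord n (d : 'rV[R]_n) (w : 'I_n -> R) :
  node_poly [seq (d 0 i, w i) | i <- enum 'I_n] = \prod_i ('X - (d 0 i)%:P).
Proof. by rewrite /node_poly big_map big_enum. Qed.

Lemma weight_poly_ord n (d : 'rV[R]_n) (w : 'I_n -> R) :
  weight_poly [seq (d 0 i, w i) | i <- enum 'I_n]
  = \sum_i w i *: \prod_(l | l != i) ('X - (d 0 l)%:P).
Proof.
rewrite /weight_poly big_map big_enum node_poly_ord; apply: eq_bigr => i _ /=.
by rewrite (bigD1 i) //= mulKp ?polyXsubC_eq0.
Qed.

(** Next to the cofactor of ['X - s], the factor [p] may be replaced by [p.[s]] modulo
    [node_poly L], as ['X - s] divides the difference. The cofactors are monic of degree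
    [(size L).-1], so the top coefficient collects the weighted values: a sum of residues. *)
Lemma coef_weight_poly_mod L (p : {poly R}) :
  weighted_sum L (horner p) = ((weight_poly L * p) %% node_poly L)`_(size L).-1.
Proof.
have E : (weight_poly L * p) %% node_poly L
    = \sum_(x <- L) (x.2 * p.[x.1]) *: (node_poly L %/ ('X - x.1%:P)).
  rewrite /weight_poly mulr_suml (big_morph _ (modpD _) (mod0p _)).
  rewrite big_seq [RHS]big_seq; apply: eq_bigr => x xL.
  have /factor_theorem [q Eq] : root (p - (p.[x.1])%:P) x.1.
    by rewrite /root !hornerE subrr.
  have -> : x.2 *: (node_poly L %/ ('X - x.1%:P)) * p
      = (x.2 *: q) * node_poly L + (x.2 * p.[x.1]) *: (node_poly L %/ ('X - x.1%:P)).
    rewrite -[p in LHS](subrK (p.[x.1])%:P) Eq.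
    have := node_poly_divK xL; move: (_ %/ _) => h <-.
    by rewrite -!mul_polyC polyCM; ring.
  rewrite modpD modp_mull add0r modp_small //.
  apply: leq_ltn_trans (size_scale_leq _ _) _.
  rewrite size_divp ?polyXsubC_eq0 // size_XsubC subn1 prednK ?size_node_poly //.
rewrite E coef_sum /weighted_sum big_seq [RHS]big_seq; apply: eq_bigr => x xL.
by rewrite coefZ coef_node_poly_div ?mulr1.
Qed.

Lemma horner_weight_div L x y : uniq (map fst L) -> x \in L -> y \in L ->
  x != y -> (node_poly L %/ ('X - x.1%:P)).[y.1] = 0.
Proof.
move=> uL xL yL xy; have := congr1 (horner^~ y.1) (node_poly_divK xL).
rewrite hornerM hornerXsubC.
have /rootP -> : root (node_poly L) y.1 by rewrite root_node_poly (map_f fst).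
move/eqP; rewrite mulf_eq0 subr_eq0 => /orP [/eqP //|/eqP xy1].
suff E : x = y by rewrite E eqxx in xy.
elim: L uL xL yL => [//|z L IH] /= /andP [zL uL]; rewrite !inE.
case/orP => [/eqP Ex|xL']; case/orP => [/eqP Ey|yL'].
- by rewrite Ex Ey.
- by move: zL; rewrite -Ex -xy1 (map_f fst).
- by move: zL; rewrite -Ey xy1 (map_f fst).
- exact: IH.
Qed.

(** At a node [s] of weight [c], [weight_poly L] is [c] times the cofactor of ['X - s]. As this
    equals [P.[s] ^+ 2], the number [c * f s] is the Lagrange coefficient of [P ^+ 2 * f] at [s],
    and the weighted sum is its divided difference. *)
Lemma interpolation_weighted_sum L f P : uniq (map fst L) ->
  weight_poly L = P ^+ 2 ->
  exists l : {poly R}, [/\ (size l <= size L)%N,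
    {in map fst L, forall s, l.[s] = P.[s] ^+ 2 * f s} &
    l`_(size L).-1 = weighted_sum L f].
Proof.
move=> uL EP.
exists (\sum_(x <- L) (x.2 * f x.1) *: (node_poly L %/ ('X - x.1%:P))); split.
- apply: (leq_trans (size_sum _ _ _)); apply/bigmax_leqP_seq => x xL _.
  apply: leq_trans (size_scale_leq _ _) _.
  by rewrite size_divp ?polyXsubC_eq0 // size_XsubC subn1 size_node_poly.
- have H (c : R * R -> R) y : y \in L ->
    (\sum_(x <- L) c x *: (node_poly L %/ ('X - x.1%:P))).[y.1]
    = c y * (node_poly L %/ ('X - y.1%:P)).[y.1].
    move=> yL; have uL' := map_uniq uL.
    rewrite horner_sum (bigD1_seq y) //= hornerZ big_seq_cond big1 ?addr0 //.
    move=> x /andP [xL xy]; rewrite hornerZ horner_weight_div ?mulr0 //.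
  move=> _ /mapP [y yL ->]; rewrite H // -horner_exp -EP /weight_poly.
  by rewrite (H (fun x => x.2)) // mulrAC.
rewrite coef_sum /weighted_sum big_seq [RHS]big_seq; apply: eq_bigr => x xL.
by rewrite coefZ coef_node_poly_div ?mulr1.
Qed.

Lemma perm_node_repeat L : ~~ uniq (map fst L) ->
  exists s a b L0, perm_eq L ((s, a) :: (s, b) :: L0).
Proof.
elim: L => [//|[s a] L IH] /=; rewrite negb_and negbK => /orP [|/IH].
  move=> /mapP [[s' b] yL /= ->]; exists s', a, b, (rem (s', b) L).
  by rewrite perm_cons perm_to_rem.
move=> [t [b [e [L0 pL]]]]; exists t, b, e, ((s, a) :: L0).
have -> : (t, b) :: (t, e) :: (s, a) :: L0 = [:: (t, b); (t, e)] ++ [:: (s, a)] ++ L0 by [].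
by rewrite perm_sym perm_catCA /= perm_cons perm_sym.
Qed.

(* A double node [s] makes [P] vanish at [s]; dividing the identity by
   [('X - s) ^+ 2] removes two copies of the node. *)
Lemma weighted_sum_distinct n L P : size L = (2 * n)%N -> (size P <= n)%N ->
  weight_poly L = P ^+ 2 ->
  exists (m : nat) (L' : seq (R * R)) (P' : {poly R}),
    [/\ (m <= n)%N, size L' = (2 * m)%N, (size P' <= m)%N,
        weight_poly L' = P' ^+ 2 & uniq (map fst L')] /\
    {subset map fst L' <= map fst L} /\
    (forall g, weighted_sum L g = weighted_sum L' g).
Proof.
elim: n L P => [|n IH] L P sL sP EP.
  by exists 0%N, L, P; do 2?split=> //; move: sL; rewrite muln0 => /size0nil ->.
have [uL|nuL] := boolP (uniq (map fst L)).
  by exists n.+1, L, P; do 2?split.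
have [s [a [b [L0 pL]]]] := perm_node_repeat nuL.
have X0 : 'X - s%:P != 0 :> {poly R} by rewrite polyXsubC_eq0.
have sL0 : size L0 = (2 * n)%N.
  by move: (perm_size pL); rewrite sL /= mulnS => -[].
have EP' : ('X - s%:P) * ((a + b) *: node_poly L0 + ('X - s%:P) * weight_poly L0) = P ^+ 2.
  rewrite -EP (perm_weight_poly pL) !weight_poly_cons node_poly_cons /=.
  by rewrite -!mul_polyC polyCD; ring.
have /factor_theorem [P1 EP1] : root P s.
  by rewrite /root -sqrf_eq0 -horner_exp -EP' hornerM hornerXsubC subrr mul0r.
have sP1 : (size P1 <= n)%N.
  have [->|P10] := eqVneq P1 0; first by rewrite size_poly0.
  by move: sP; rewrite EP1 size_Mmonic ?monicXsubC // size_XsubC addn2.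
have {EP'} EP1' : (a + b) *: node_poly L0 + ('X - s%:P) * weight_poly L0
    = ('X - s%:P) * P1 ^+ 2.
  by apply: (mulfI X0); rewrite EP' EP1 exprMn; ring.
have subL0 : {subset map fst L0 <= map fst L}.
  by move=> t tL0; rewrite (perm_mem (perm_map fst pL)) !inE tL0 !orbT.
(* If the two weights cancel, both copies leave the sum. Otherwise [EP1'] at [s] forces a third copy
   in [L0], and the three merge into one node of weight [a + b + e]. Two nodes are lost either
   way. *)
have [ab0|ab0] := eqVneq (a + b) 0.
  have /(IH _ _ sL0 sP1) [m [L' [P' [[mn sL' sP' EL' uL'] [sub E]]]]] : weight_poly L0 = P1 ^+ 2.
    by apply: (mulfI X0); rewrite -EP1' ab0 scale0r add0r.
  exists m, L', P'; split; first by split => //; exact: leqW.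
  split=> [t /sub tL0|g]; first exact: subL0.
   rewrite (perm_weighted_sum g pL) !weighted_sum_cons /= addrA -mulrDl.
  by rewrite ab0 mul0r add0r.
have /mapP [[s' e] yL0 /= ?] : s \in map fst L0.
  rewrite -root_node_poly /root; have := congr1 (horner^~ s) EP1'.
  rewrite hornerD hornerZ !hornerM hornerXsubC subrr !mul0r addr0 => /eqP.
  rewrite mulf_eq0.
  by rewrite (negbTE ab0).
subst s'; pose L1 := rem (s, e) L0.
have pL0 : perm_eq L0 ((s, e) :: L1) by exact: perm_to_rem.
pose L2 := (s, a + b + e) :: L1.
have EL2 : weight_poly L2 = P1 ^+ 2.
  apply: (mulfI X0); rewrite -EP1' (perm_weight_poly pL0) (perm_node_poly pL0).
  by rewrite !weight_poly_cons node_poly_cons /= -!mul_polyC polyCD; ring.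
have sL2 : size L2 = (2 * n)%N by rewrite -sL0 (perm_size pL0).
have [m [L' [P' [[mn sL' sP' EL' uL'] [sub E]]]]] := IH _ _ sL2 sP1 EL2.
exists m, L', P'; split; first by split => //; exact: leqW.
split.
  move=> t /sub tL2; apply: subL0; rewrite (perm_mem (perm_map fst pL0)).
  exact: tL2.
move=> g; rewrite (perm_weighted_sum g pL) -E !weighted_sum_cons /=.
rewrite (perm_weighted_sum g pL0) !weighted_sum_cons /=; ring.
Qed.

End WeightedNodes.

(** * Higher derivatives and Taylor polynomials *)

Section NDerivable.
Variables (R : realType) (V : set R).
Hypothesis openV : open V.
Implicit Types (f g : R -> R) (n : nat) (x : R).

Lemma near_open x (P : R -> Prop) : V x -> (forall y, V y -> P y) -> \near x, P x.
Proof. by move=> Vx VP; apply: filterS VP _; exact: open_nbhs_nbhs. Qed.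

Lemma is_derive_derive1 f x : derivable f x 1 -> is_derive x 1 f (f^`() x).
Proof. by move=> df; rewrite derive1E; exact: derivableP. Qed.

Lemma eq_derive1_on f g : (forall x, V x -> f x = g x) ->
  forall x, V x -> f^`() x = g^`() x.
Proof.
by move=> fg x Vx; rewrite !derive1E; apply: near_eq_derive; exact: near_open.
Qed.

Lemma eq_derive1n_on n f g : (forall x, V x -> f x = g x) ->
  forall x, V x -> f^`(n) x = g^`(n) x.
Proof.
elim: n f g => [//|n IH] f g fg x Vx; rewrite !derive1Sn; apply: IH => //.
exact: eq_derive1_on.
Qed.

Lemma eq_nderivable_on n f g : (forall x, V x -> f x = g x) ->
  nderivable_on V n f -> nderivable_on V n g.
Proof.
move=> fg nf j jn x Vx; apply: near_eq_derivable (nf j jn x Vx).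
by apply: near_open => // y Vy; exact: eq_derive1n_on.
Qed.

Lemma nderivable_onS n f : nderivable_on V n.+1 f ->
  (forall x, V x -> derivable f x 1) /\ nderivable_on V n f^`().
Proof.
move=> nf; split=> [x Vx|j jn x Vx]; first exact: (nf 0%N).
by rewrite -derive1Sn; exact: nf.
Qed.

Lemma nderivable_on_is_derive n f f' : nderivable_on V n f' ->
  (forall x, V x -> is_derive x 1 f (f' x)) -> nderivable_on V n.+1 f.
Proof.
move=> nf' df [|j] jn x Vx; first by have [] := df x Vx.
rewrite derive1Sn; apply: (@eq_nderivable_on n f') => // y Vy.
by have [_ <-] := df y Vy; rewrite derive1E.
Qed.

Lemma nderivable_on0 f : nderivable_on V 0 f. Proof. by []. Qed.

Lemma nderivable_on_le n m f : (m <= n)%N ->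
  nderivable_on V n f -> nderivable_on V m f.
Proof. by move=> mn nf j jm; apply: nf; exact: leq_trans mn. Qed.

Lemma nderivable_on_cst n (c : R) : nderivable_on V n (fun=> c).
Proof.
elim: n c => [|n IH] c; first exact: nderivable_on0.
 apply: (@nderivable_on_is_derive _ _ (fun=> 0)) => //.
Qed.

Lemma nderivable_on_id n : nderivable_on V n id.
Proof.
case: n => [|n]; first exact: nderivable_on0.
apply: (@nderivable_on_is_derive _ _ (fun=> 1)) => //.
exact: nderivable_on_cst.
Qed.

Lemma nderivable_onD n f g : nderivable_on V n f -> nderivable_on V n g ->
  nderivable_on V n (fun x => f x + g x).
Proof.
elim: n f g => [|n IH] f g; first by move=> _ _; apply: nderivable_on0.
move=> /nderivable_onS[df nf] /nderivable_onS[dg ng].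
apply: (@nderivable_on_is_derive _ _ (fun x => derive1 f x + derive1 g x)); first exact: IH.
move=> x Vx; have := is_derive_derive1 (df x Vx); have := is_derive_derive1 (dg x Vx).
by move=> ? ?; exact: is_deriveD.
Qed.

Lemma nderivable_onM n f g : nderivable_on V n f -> nderivable_on V n g ->
  nderivable_on V n (fun x => f x * g x).
Proof.
elim: n f g => [|n IH] f g; first by move=> _ _; apply: nderivable_on0.
move=> nf ng; have [df nf'] := nderivable_onS nf; have [dg ng'] := nderivable_onS ng.
apply: (@nderivable_on_is_derive _ _ (fun x => f x * derive1 g x + g x * derive1 f x)).
  by apply: nderivable_onD; apply: IH;
    [exact: nderivable_on_le nf|exact: ng'|exact: nderivable_on_le ng|exact: nf'].
move=> x Vx; have := is_derive_derive1 (df x Vx); have := is_derive_derive1 (dg x Vx).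
by move=> ? ?; exact: is_deriveM.
Qed.

Lemma nderivable_on_horner n (p : {poly R}) f : nderivable_on V n f ->
  nderivable_on V n (fun x => p.[f x]).
Proof.
move=> nf; elim/poly_ind: p => [|p c IH].
  by apply: (@eq_nderivable_on _ (fun=> 0)); [move=> x _; rewrite horner0|exact: nderivable_on_cst].
apply: (@eq_nderivable_on _ (fun x => p.[f x] * f x + c)).
  by move=> x _; rewrite hornerMXaddC.
by apply: nderivable_onD; [exact: nderivable_onM IH nf|exact: nderivable_on_cst].
Qed.

Lemma nderivable_onV n f : (forall x, V x -> f x != 0) ->
  nderivable_on V n f -> nderivable_on V n (fun x => (f x)^-1).
Proof.
move=> f0; elim: n => [|n IH]; first by move=> _; apply: nderivable_on0.
move=> nf; have [df nf'] := nderivable_onS nf.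
have nV : nderivable_on V n (fun x => (f x)^-1).
  exact: IH (nderivable_on_le (leqnSn _) nf).
apply: (@nderivable_on_is_derive _ _ (fun x => (-1) * ((f x)^-1 * (f x)^-1) * derive1 f x)).
  apply: nderivable_onM nf'; apply: nderivable_onM; first exact: nderivable_on_cst.
  exact: (nderivable_onM nV nV).
move=> x Vx; have dfx := is_derive_derive1 (df x Vx).
have := is_deriveV (f0 x Vx) dfx.
by rewrite mulN1r -invfM -expr2.
Qed.

End NDerivable.

Lemma nderivable_on_sub (R : realType) (V W : set R) n (f : R -> R) :
  V `<=` W -> nderivable_on W n f -> nderivable_on V n f.
Proof. by move=> VW nf j jn x /VW; exact: nf. Qed.

(** * Polynomials modulo a power of ['X], and Taylor polynomials *)

Section CoefEq.
Variable R : realType.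
Implicit Types p q : {poly R}.

Definition eqmodX n p q := forall i, (i < n)%N -> p`_i = q`_i.

Lemma eqmodX_refl n p : eqmodX n p p. Proof. by []. Qed.
Lemma eqmodX_sym n p q : eqmodX n p q -> eqmodX n q p.
Proof. by move=> E i /E ->. Qed.
Lemma eqmodX_trans n q p r : eqmodX n p q -> eqmodX n q r -> eqmodX n p r.
Proof. by move=> E F i ni; rewrite E // F. Qed.
Lemma eqmodX_le n m p q : (m <= n)%N -> eqmodX n p q -> eqmodX m p q.
Proof. by move=> mn E i im; rewrite E // (leq_trans im). Qed.
Lemma eqmodXD n p q r s : eqmodX n p q -> eqmodX n r s -> eqmodX n (p + r) (q + s).
Proof. by move=> E F i ni; rewrite !coefD E // F. Qed.
Lemma eqmodXM n p q r s : eqmodX n p q -> eqmodX n r s -> eqmodX n (p * r) (q * s).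
Proof.
move=> E F i ni; rewrite !coefM; apply: eq_bigr => -[j /= ji] _.
by rewrite E ?F //; apply: leq_ltn_trans ni; rewrite ?leq_subr // -ltnS.
Qed.

(** In characteristic zero the derivative determines all coefficients but the constant one; jet
    identities can thus be proved by induction on the order. *)
Lemma eqmodX_deriv n p q : p`_0 = q`_0 -> eqmodX n p^`() q^`() -> eqmodX n.+1 p q.
Proof.
move=> E F [//|i] ni; have := F i ni; rewrite !coef_deriv.
by move=> /eqP; rewrite eqrMn2r // => /eqP.
Qed.

End CoefEq.

Section Jet.
Variable R : realType.
Implicit Types (f g : R -> R) (x : R) (V : set R).

(** The Taylor polynomial in the displacement from [x], so that rules of calculus become congruences
    modulo ['X^n.+1]. *)
Definition jet f n x : {poly R} := \poly_(j < n.+1) (derive1n j f x / j`!%:R).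

Lemma coef_jet f n x j : (j <= n)%N -> (jet f n x)`_j = derive1n j f x / j`!%:R.
Proof. by move=> jn; rewrite coef_poly ltnS jn. Qed.

Lemma jet0 f n x : (jet f n x)`_0 = f x.
Proof. by rewrite coef_jet // divr1. Qed.

Lemma deriv_jet f n x : deriv (jet f n.+1 x) = jet (derive1 f) n x.
Proof.
apply/polyP => i; rewrite coef_deriv !coef_poly ltnS; case: ifP => _; last by rewrite mul0rn.
rewrite derive1Sn factS -[_ *+ i.+1]mulr_natr natrM invfM.
by rewrite [_^-1 * _^-1]mulrC mulrA divfK ?pnatr_eq0.
Qed.

Lemma eq_jet V f g n x : open V -> V x -> (forall y, V y -> f y = g y) ->
  jet f n x = jet g n x.
Proof.
move=> oV Vx fg; apply/polyP => i; rewrite !coef_poly.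
by rewrite (eq_derive1n_on oV _ fg Vx).
Qed.

Lemma eqmodX_jet_le f n m x : (m <= n)%N -> eqmodX m.+1 (jet f m x) (jet f n x).
Proof. by move=> mn i im; rewrite !coef_jet // (leq_trans _ mn). Qed.

Lemma jetD V f g n x : open V -> V x -> nderivable_on V n f -> nderivable_on V n g ->
  jet (fun y => f y + g y) n x = jet f n x + jet g n x.
Proof.
move=> oV Vx nf ng.
suff H j : (j <= n)%N -> derive1n j (fun y => f y + g y) x = derive1n j f x + derive1n j g x.
  apply/polyP => i; rewrite coefD !coef_poly; case: ifP => [im|_]; last by rewrite addr0.
  by rewrite H // mulrDl.
elim: n f g j nf ng => [|n IH] f g j nf ng; first by rewrite leqn0 => /eqP ->.
case: j => [//|j] jn.
rewrite !derive1Sn; have [df nf'] := nderivable_onS nf; have [dg ng'] := nderivable_onS ng.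
rewrite -(IH _ _ j nf' ng' jn); apply: (eq_derive1n_on oV) Vx => y Vy.
have Df := is_derive_derive1 (df y Vy); have Dg := is_derive_derive1 (dg y Vy).
by rewrite derive1E; have [_ ->] := is_deriveD Df Dg.
Qed.

(** Leibniz's rule without binomial sums: the constant terms agree, and the derivatives agree by
    induction applied to [f * g'] and [g * f']. *)
Lemma jetM V f g n x : open V -> V x -> nderivable_on V n f -> nderivable_on V n g ->
  eqmodX n.+1 (jet (fun y => f y * g y) n x) (jet f n x * jet g n x).
Proof.
move=> oV Vx; elim: n f g => [|n IH] f g nf ng.
  by move=> [|//] _; rewrite coef0M !jet0.
apply: eqmodX_deriv; first by rewrite coef0M !jet0.
have [df nf'] := nderivable_onS nf; have [dg ng'] := nderivable_onS ng.
have nf0 := nderivable_on_le (leqnSn _) nf; have ng0 := nderivable_on_le (leqnSn _) ng.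
rewrite derivM !deriv_jet.
rewrite (@eq_jet V _ (fun y => f y * derive1 g y + g y * derive1 f y) n x oV Vx); last first.
  move=> y Vy; have Df := is_derive_derive1 (df y Vy); have Dg := is_derive_derive1 (dg y Vy).
  by rewrite derive1E; have [_ ->] := is_deriveM Df Dg.
rewrite (jetD oV Vx (nderivable_onM oV nf0 ng') (nderivable_onM oV ng0 nf')).
rewrite addrC (mulrC (jet (derive1 f) n x)); apply: eqmodXD.
  apply: eqmodX_trans (IH _ _ ng0 nf') _; apply: eqmodXM; last exact: eqmodX_refl.
  exact: eqmodX_jet_le.
apply: eqmodX_trans (IH _ _ nf0 ng') _; apply: eqmodXM; last exact: eqmodX_refl.
exact: eqmodX_jet_le.
Qed.

Lemma jet_cst (c : R) n x : jet (fun=> c) n x = c%:P.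
Proof.
have H j : derive1n j.+1 (fun _ : R => c) = fun=> 0.
  elim: j => [|j IH]; first by rewrite derive1n1; apply/funext => y; rewrite derive1_cst.
  by rewrite derive1nS IH; apply/funext => y; rewrite derive1_cst.
apply/polyP => -[|i]; rewrite coef_poly coefC; first by rewrite divr1.
by rewrite (congr1 (@^~ x) (H i)) mul0r; case: ifP.
Qed.

Lemma jet_horner V f n x (p : {poly R}) : open V -> V x -> nderivable_on V n f ->
  eqmodX n.+1 (jet (fun y => p.[f y]) n x) (p \Po jet f n x).
Proof.
move=> oV Vx nf; elim/poly_ind: p => [|p c IH].
  rewrite comp_poly0 (@eq_jet V _ (fun=> 0) n x oV Vx) ?jet_cst; first exact: eqmodX_refl.
  by move=> y _; rewrite horner0.
rewrite (@eq_jet V _ (fun y => p.[f y] * f y + c) n x oV Vx); last first.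
  by move=> y _; rewrite hornerMXaddC.
have np : nderivable_on V n (fun y => p.[f y]) by exact: nderivable_on_horner.
rewrite (jetD oV Vx (nderivable_onM oV np nf) (@nderivable_on_cst _ _ oV n c)).
rewrite comp_polyD comp_polyM comp_polyX comp_polyC jet_cst.
apply: eqmodXD; last exact: eqmodX_refl.
apply: eqmodX_trans (jetM oV Vx np nf) _.
by apply: eqmodXM IH _; exact: eqmodX_refl.
Qed.

Lemma jet_id n x : jet id n.+1 x = 'X + x%:P.
Proof.
have H0 j : derive1n j.+2 (id : R -> R) x = 0.
  rewrite derive1Sn (_ : derive1 id = fun=> 1); last by apply/funext => y; rewrite derive1_id.
  have := jet_cst 1 j.+1 x => /polyP /(_ j.+1); rewrite coef_jet // coefC => /eqP.
  by rewrite mulf_eq0 invr_eq0 pnatr_eq0 -leqn0 leqNgt fact_gt0 orbF => /eqP.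
apply/polyP => i; rewrite coefD coefX coefC coef_poly.
case: i => [|[|i]]; first by rewrite divr1 add0r.
  by rewrite derive1n1 derive1_id divr1 addr0.
by rewrite H0 mul0r addr0; case: ifP.
Qed.

End Jet.

(** Between neighbours in the sorted list of zeros, Rolle gives a strictly sorted list of zeros of
    the derivative with one element less; all of them lie in [V] because [V] is an interval. *)
Lemma iterated_rolle (R : realType) (V : set R) n (g : R -> R) (zs : seq R) :
  is_interval V -> nderivable_on V n g -> uniq zs -> size zs = n.+1 ->
  (forall z, z \in zs -> V z /\ g z = 0) ->
  exists2 xi, V xi & g^`(n) xi = 0.
Proof.
move=> itvV ng uz sz zsP.
have {uz} : sorted <%R (sort <=%R zs) by rewrite sort_lt_sorted.
have : forall z, z \in sort <=%R zs -> V z /\ g z = 0.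
  by move=> z; rewrite mem_sort; exact: zsP.
have : size (sort <=%R zs) = n.+1 by rewrite size_sort.
move: (sort <=%R zs) => {sz zsP} {}zs; elim: n g ng zs => [|n IH] g ng zs.
  by case: zs => [//|z zs] _ /(_ z (mem_head _ _)) [Vz gz] _; exists z.
have [dg ng'] := nderivable_onS ng.
have rolle z ws : V z -> g z = 0 -> (forall w, w \in ws -> V w /\ g w = 0) ->
    path <%R z ws -> exists us, [/\ size us = size ws, path <%R z us &
      forall w, w \in us -> V w /\ g^`() w = 0].
  elim: ws z => [|t ws IHw] z Vz gz wsP /=; first by exists [::].
  move=> /andP [zt ptw]; have [Vt gt] := wsP t (mem_head _ _).
  have [|us [sus pus usP]] := IHw t Vt gt _ ptw.
    by move=> w ww; apply: wsP; rewrite inE ww orbT.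
  have Vc c : z <= c <= t -> V c by exact: itvV.
  have [|||c cI Dc] := @Rolle R g z t zt.
  - by move=> c cI; apply/dg/Vc; rewrite !ltW ?(itvP cI).
  - apply: derivable_within_continuous => c cI; apply/dg/Vc.
    by rewrite !(itvP cI).
  - by rewrite gz gt.
  exists (c :: us); split=> /=; first by rewrite sus.
    rewrite (itvP cI) (path_le lt_trans _ pus) // (itvP cI) //.
  move=> w; rewrite inE => /orP [/eqP ->|]; last exact: usP.
  by rewrite derive1E; have [_ ->] := Dc; split=> //; apply: Vc; rewrite !ltW ?(itvP cI).
case: zs => [//|z zs] /= [szs] zsP pzs.
have [Vz gz] := zsP z (mem_head _ _).
have [|us [sus pus usP]] := rolle z zs Vz gz _ pzs.
  by move=> w ww; apply: zsP; rewrite inE ww orbT.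
have [|xi Vxi E] := IH _ ng' us _ usP (path_sorted pus); first by rewrite sus.
by exists xi => //; rewrite -[LHS]/(derive1n n.+1 g xi) derive1Sn.
Qed.

(** Continuity of the top derivative is not assumed. The mean value theorem along the segment from
    [x] to [x + s] bounds the remainder of [f] by [|s|] times that of [f']; the base case is
    differentiability in Caratheodory's form. *)
Lemma taylor_peano (R : realType) (V : set R) n (f : R -> R) (x e : R) :
  open V -> V x -> nderivable_on V n.+1 f -> 0 < e ->
  exists2 d : R, 0 < d & forall s, `|s| < d ->
    `|f (x + s) - (jet f n.+1 x).[s]| <= e * `|s| ^+ n.+1.
Proof.
move=> oV Vx; elim: n f => [|n IH] f nf e0.
  have [df _] := nderivable_onS nf.
  have /is_derive1_caratheodory [g [fg cg gx]] := is_derive_derive1 (df x Vx).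
  move/cvgrPdist_le/(_ e e0)/nbhs_ballP : cg => [d /= d0 dP].
  exists d => // s sd.
  have -> : (jet f 1 x).[s] = f x + g x * s.
    by rewrite horner_poly !big_ord_recl big_ord0 /= gx !divr1 expr0 mulr1 addr0.
  have -> : f (x + s) - (f x + g x * s) = (g (x + s) - g x) * s.
    by rewrite opprD addrA fg; ring.
  rewrite normrM expr1 ler_wpM2r // distrC dP //=.
  by rewrite /ball /= opprD addrA subrr add0r normrN.
have [df nf'] := nderivable_onS nf.
have [d1 d10 d1P] := IH _ nf' e0.
have /nbhs_ballP [d2 /= d20 d2P] : nbhs x V by exact: open_nbhs_nbhs.
exists (Num.min d1 d2); first by rewrite lt_min d10.
move=> s; rewrite lt_min => /andP [sd1 sd2].
have bnd (t : R) : 0 <= t <= 1 -> `|t * s| <= `|s|.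
  by move=> /andP [t0 t1]; rewrite normrM ger0_norm // ler_piMl.
have Vt (t : R) : 0 <= t <= 1 -> V (x + t * s).
  move=> /bnd ts; apply: d2P; rewrite /ball /= opprD addrA subrr add0r normrN.
  exact: le_lt_trans ts sd2.
pose r (t : R) : R := f (x + t * s) - (jet f n.+2 x).[t * s].
pose r' (t : R) : R := (f^`()%classic (x + t * s) - (jet f^`()%classic n.+1 x).[t * s]) * s.
have lin (a t : R) : is_derive t 1 (fun t : R => a + t * s) s.
  rewrite (_ : (fun t => a + t * s) = horner (s *: 'X + a%:P)); last first.
    by apply/funext => u; rewrite !hornerE addrC mulrC.
  have := is_derive_poly (s *: 'X + a%:P) t.
  by rewrite derivD derivZ derivX derivC addr0 hornerZ hornerC mulr1.
have Dr (t : R) : 0 <= t <= 1 -> is_derive t 1 r (r' t).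
  move=> tI; rewrite /r' mulrBl; apply: is_deriveB.
    apply: (@is_derive1_comp _ f (fun t => x + t * s)).
    exact: is_derive_derive1 (df _ (Vt t tI)).
  have D1 := is_derive_poly (jet f n.+2 x) (t * s).
  have D2 : is_derive t 1 (fun t : R => t * s) s.
    by have := lin 0 t; under [X in is_derive _ _ X]eq_fun do rewrite add0r.
  by rewrite -deriv_jet; exact: (@is_derive1_comp _ (horner _) (fun u => u * s) t _ _ D1 D2).
have [||c cI] := @MVT_segment R r r' 0 1 ler01.
- by move=> t tI; apply: Dr; rewrite !ltW ?(itvP tI).
- by apply: derivable_within_continuous => t tI; have [] := Dr t; rewrite ?(itvP tI).
have c01 : 0 <= c <= 1 by rewrite !(itvP cI).
rewrite subr0 mulr1 {1}/r mul1r {1}/r !mul0r addr0 horner_coef0 jet0 subrr subr0 => ->.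
rewrite /r' normrM exprSr mulrA ler_wpM2r //.
apply: le_trans (d1P _ _) _; first exact: le_lt_trans (bnd c c01) sd1.
by apply: ler_wpM2l (ltW e0) _ _ _; apply: lerXn2r; rewrite ?nnegrE ?bnd.
Qed.

(** * Hankel forms and divided differences *)

(* [(p ^+ 2 * F)`_(2 * n).-1] is the quadratic form of the Hankel matrix
   [F`_(i + j + 1)], [i, j < n], at the reversed coefficients of [p]. *)
Definition hankel_psd (R : realType) (F : {poly R}) n :=
  forall p : {poly R}, (size p <= n)%N -> 0 <= (p ^+ 2 * F)`_(2 * n).-1.

Section HankelPsd.
Variable R : realType.
Implicit Types F p q : {poly R}.

Lemma eqmodX_hankel_psd F G n :
  eqmodX (2 * n) F G -> hankel_psd F n -> hankel_psd G n.
Proof.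
case: n => [|n] FG hF p sp.
  by rewrite (size_poly_leq0P p sp) expr0n mul0r coef0.
have := hF p sp; rewrite (_ : (p ^+ 2 * F)`_ _ = (p ^+ 2 * G)`_(2 * n.+1).-1) //.
by apply: (@eqmodXM _ (2 * n.+1)) => //; lia.
Qed.

(** Multiplication of [p] by a power of ['X] embeds the smaller form in the larger one. *)
Lemma hankel_psd_le F n m : (m <= n)%N -> hankel_psd F n -> hankel_psd F m.
Proof.
move=> mn hF p sp; case: m mn sp => [|m] mn sp.
  by rewrite (size_poly_leq0P p sp) expr0n mul0r coef0.
have := hF (p * 'X^(n - m.+1)); rewrite exprMn -exprM mulrAC coefMXn.
have -> : ((2 * n).-1 < (n - m.+1) * 2)%N = false by lia.
have -> : ((2 * n).-1 - (n - m.+1) * 2 = (2 * m.+1).-1)%N by lia.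
apply; apply: leq_trans (size_polyMleq _ _) _; rewrite size_polyXn; lia.
Qed.

End HankelPsd.

Lemma coef_comp_shift (R : idomainType) (p : {poly R}) (c : R) n :
  (size p <= n.+1)%N -> (p \Po ('X + c%:P))`_n = p`_n.
Proof.
move=> sp; have s2 : size ('X + c%:P) = 2 by rewrite size_XaddC.
have := size_comp_poly2 p s2 => spX; move: sp; rewrite leq_eqVlt => /orP [/eqP Es|].
  have := @lead_coef_comp R p ('X + c%:P); rewrite s2 lead_coefXaddC expr1n mulr1.
  by move=> /(_ isT); rewrite !lead_coefE spX Es.
by rewrite ltnS => sp; rewrite !nth_default ?spX.
Qed.

(* With distinct nodes the sum is the divided difference of [P ^+ 2 * f], hence
   a value of its highest derivative. *)
Lemma weighted_sum_ge0 (R : realType) (V : set R) n (f : R -> R)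
    (L : seq (R * R)) (P : {poly R}) :
  open V -> is_interval V -> nderivable_on V (2 * n).-1 f ->
  (forall x, V x -> hankel_psd (jet f (2 * n).-1 x) n) ->
  size L = (2 * n)%N -> (size P <= n)%N -> weight_poly L = P ^+ 2 ->
  {in map fst L, forall s, V s} -> 0 <= weighted_sum L f.
Proof.
move=> oV iV; move: n L P => N L0 P0 nf0 hf0 sL0 sP0 E0 V0.
have [m [L [P [[mN sL sP EP uL] [sub ->]]]]] := weighted_sum_distinct sL0 sP0 E0.
case: m mN sL sP => [|n] mN sL sP.
  by rewrite (size0nil sL) /weighted_sum big_nil.
have V1 : {in map fst L, forall s, V s} by move=> s /sub; exact: V0.
pose k := (2 * n)%N; have Ek : (2 * n.+1).-1 = k.+1 by rewrite /k; lia.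
have nf : nderivable_on V k.+1 f by apply: nderivable_on_le nf0; rewrite /k; lia.
have hf x : V x -> hankel_psd (jet f k.+1 x) n.+1.
  move=> Vx; apply: (eqmodX_hankel_psd _ (hankel_psd_le mN (hf0 x Vx))).
  by apply: eqmodX_sym; apply: eqmodX_le (eqmodX_jet_le _ _ _); rewrite /k; lia.
have [l [sl lP lN]] := interpolation_weighted_sum f uL EP.
(* [g] vanishes at [k.+2] distinct nodes, so its derivative of order [k.+1] vanishes at some [xi].
   There the top coefficient of [l], unchanged by recentring, equals that of [P ^+ 2 * f], which is
   the Hankel form at the recentred [P]. *)
pose g x := (P ^+ 2).[x] * f x + (- l).[x].
have np (p : {poly R}) : nderivable_on V k.+1 (horner p).
  exact: (nderivable_on_horner oV (@nderivable_on_id _ _ oV _)).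
have nPf : nderivable_on V k.+1 (fun x => (P ^+ 2).[x] * f x).
  exact: (nderivable_onM oV (np _) nf).
have ng : nderivable_on V k.+1 g by exact: (nderivable_onD oV nPf (np _)).
have [||xi Vxi gxi] := iterated_rolle iV ng uL.
- by rewrite size_map sL; lia.
- by move=> z zL; split; [exact: V1|rewrite /g hornerN lP // horner_exp subrr].
have jetp (p : {poly R}) : eqmodX k.+2 (jet (horner p) k.+1 xi) (p \Po ('X + xi%:P)).
  have := jet_horner p oV Vxi (@nderivable_on_id _ _ oV k.+1).
  by rewrite jet_id.
have := coef_jet g xi (leqnn k.+1); rewrite gxi mul0r /g.
have skl : (size (- l) <= k.+2)%N by rewrite size_polyN (leq_trans sl) // sL; lia.
rewrite (jetD oV Vxi nPf (np _)) coefD [X in _ + X]jetp // (coef_comp_shift _ skl) coefN.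
have -> : l`_k.+1 = weighted_sum L f by rewrite -lN sL Ek.
move=> /eqP; rewrite subr_eq0 => /eqP <-.
rewrite (jetM oV Vxi (np _) nf) //.
rewrite (eqmodXM (jetp _) (@eqmodX_refl _ k.+2 _)) // expr2 comp_polyM -expr2.
have := hf xi Vxi (P \Po ('X + xi%:P)); rewrite Ek; apply.
by rewrite size_comp_poly2 ?size_XaddC.
Qed.

(** * Functional calculus *)

Lemma matrix_entry (T : Type) m n (A B : 'M[T]_(m, n)) i j : A = B -> A i j = B i j.
Proof. by move->. Qed.

Section MatrixFunction.
Variable R : realType.
Implicit Types (f : R -> R) (n : nat).

(** [M = Q *m P^T] intertwines the two diagonal matrices, so [M i j] is nonzero only where
    [e 0 i = d 0 j]; hence it also intertwines their images under [f]. *)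
Lemma is_mxfun_unique f n (A B B' : 'M[R]_n) :
  is_mxfun f A B -> is_mxfun f A B' -> B = B'.
Proof.
move=> [P [d [PP AE ->]]] [Q [e [QQ AE' ->]]].
have PTP := mulmx1C PP; have QTQ := mulmx1C QQ.
have [M ME] : exists M, M = Q *m P^T by exists (Q *m P^T).
have DM : diag_mx e *m M = M *m diag_mx d.
  have -> : diag_mx e *m M = Q *m A *m P^T.
    by rewrite AE' ME !mulmxA QQ mul1mx.
  by rewrite AE ME -!mulmxA PP mulmx1.
have DMf : diag_mx (map_mx f e) *m M = M *m diag_mx (map_mx f d).
  apply/matrixP => i j; rewrite mul_diag_mx mul_mx_diag !mxE.
  have := matrix_entry i j DM; rewrite mul_diag_mx mul_mx_diag [LHS]mxE [RHS]mxE mulrC.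
  by have [->|M0 /(mulfI M0) ->] := eqVneq (M i j) 0; rewrite ?mulr0 ?mul0r // mulrC.
have -> : Q^T *m diag_mx (map_mx f e) *m Q
    = Q^T *m (diag_mx (map_mx f e) *m M) *m P.
  by rewrite ME -!mulmxA PTP mulmx1.
by rewrite DMf ME !mulmxA QTQ mul1mx.
Qed.

Lemma mxfun_diag f n (P : 'M[R]_n) (d : 'rV[R]_n) : P *m P^T = 1%:M ->
  mxfun f (P^T *m diag_mx d *m P) = P^T *m diag_mx (map_mx f d) *m P.
Proof.
move=> PP; have H : is_mxfun f (P^T *m diag_mx d *m P) (P^T *m diag_mx (map_mx f d) *m P).
  by exists P, d.
apply: is_mxfun_unique (H).
apply: (@xgetPex _ 0 [set B | is_mxfun f _ B]).
by exists (P^T *m diag_mx (map_mx f d) *m P).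
Qed.

Lemma eigenvalue_diag n (P : 'M[R]_n) (d : 'rV[R]_n) (c : R) : P *m P^T = 1%:M ->
  reflect (exists i, c = d 0 i) (eigenvalue (P^T *m diag_mx d *m P) c).
Proof.
move=> PP; have PTP := mulmx1C PP; apply: (iffP eigenvalueP).
  move=> [v vA v0]; pose w := v *m P^T.
  have wd : w *m diag_mx d = c *: w.
    rewrite scalemxAl -vA -!mulmxA PP mulmx1 !mulmxA //.
  have /rV0Pn [i wi] : w != 0.
    apply: contra v0 => /eqP w0; rewrite -[v]mulmx1 -PTP mulmxA -/w w0 mul0mx //.
  exists i; have := matrix_entry 0 i wd; rewrite mul_mx_diag mxE [RHS]mxE mulrC.
  by move/(mulIf wi).
move=> [i ->]; exists (row i P).
  rewrite !mulmxA -row_mul PP row1 -rowE row_diag_mx -scalemxAl -rowE //.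
apply/eqP => r0; have := congr1 (row i) PP; rewrite row_mul r0 mul0mx => /rowP /(_ i) /eqP.
by rewrite !mxE eqxx eq_sym oner_eq0.
Qed.

Lemma conj_diag_sym n (P : 'M[R]_n) (d : 'rV[R]_n) :
  (P^T *m diag_mx d *m P)^T = P^T *m diag_mx d *m P.
Proof. by rewrite !trmx_mul trmxK tr_diag_mx mulmxA. Qed.

Lemma psdmxD n (A B : 'M[R]_n) : psdmx A -> psdmx B -> psdmx (A + B).
Proof.
move=> [sA pA] [sB pB]; split; first by rewrite linearD /= sA sB.
by move=> v; rewrite mulmxDr mulmxDl mxE addr_ge0.
Qed.

Lemma psdmx_outer n (v : 'cV[R]_n) : psdmx (v *m v^T).
Proof.
split=> [|x]; first by rewrite trmx_mul trmxK.
rewrite !mulmxA -mulmxA; have -> : v^T *m x = (x^T *m v)^T by rewrite trmx_mul trmxK.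
exact: row_norm_ge0.
Qed.

Lemma psdmx_sum n (s : seq 'cV[R]_n) : psdmx (\sum_(v <- s) v *m v^T).
Proof.
elim: s => [|v s IH].
  rewrite big_nil; split=> [|x]; first exact: trmx0.
  by rewrite mulmx0 mul0mx mxE.
by rewrite big_cons; exact: psdmxD (psdmx_outer v) IH.
Qed.

Lemma psdmx_sum_outer n (A : 'M[R]_n) : psdmx A ->
  exists s : seq 'cV[R]_n, A = \sum_(v <- s) v *m v^T.
Proof.
move=> [symA psdA]; have [P [d [PP AE]]] := sym_spectral symA.
exists [seq Num.sqrt (d 0 i) *: (row i P)^T | i <- enum 'I_n].
rewrite big_map big_enum /=.
have rowP i j : (P *m (row i P)^T) j 0 = (1%:M : 'M[R]_n) j i.
  by rewrite -PP !mxE; apply: eq_bigr => k _; rewrite !mxE.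
have d0 i : 0 <= d 0 i.
  have := psdA (row i P)^T; rewrite AE quad_diag (bigD1 i) //= big1 ?addr0 => [|j ji].
    by rewrite rowP mxE eqxx mul1r mulr1.
  by rewrite rowP mxE (negbTE ji) mulr0.
apply/matrixP => i j; rewrite summxE AE mxE; apply: eq_bigr => k _.
rewrite mul_mx_diag linearZ /= trmxK -scalemxAl -scalemxAr scalerA -expr2 sqr_sqrtr //.
rewrite !mxE big_ord1 !mxE; ring.
Qed.

(** For an eigenvector [x] of [C], the forms of [A] and [B] at [x] enclose [c] times the squared
    length of [x]. So [A] has an eigenvalue at most [c] and [B] one at least [c]. *)
Lemma spectrum_between (V : set R) n (A B C : 'M[R]_n) : is_interval V ->
  A^T = A -> B^T = B -> spectrum_in V A -> spectrum_in V B ->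
  loewner_le A C -> loewner_le C B -> spectrum_in V C.
Proof.
move=> iV sA sB VA VB AC CB c /eigenvalueP [x xC x0].
have xx : 0 < (x *m x^T) 0 0 by rewrite lt_neqAle eq_sym row_norm_eq0 x0 row_norm_ge0.
have formC : (x *m C *m x^T) 0 0 = c * (x *m x^T) 0 0 by rewrite xC -scalemxAl mxE.
have form (S : 'M[R]_n) (d : 'rV[R]_n) : S *m S^T = 1%:M ->
    (x *m (S^T *m diag_mx d *m S) *m x^T) 0 0 - c * (x *m x^T) 0 0
    = \sum_i (d 0 i - c) * (S *m x^T) i 0 ^+ 2.
  move=> SS; have -> : (x *m x^T) 0 0 = \sum_i (S *m x^T) i 0 ^+ 2.
    have -> : x *m x^T = (S *m x^T)^T *m (S *m x^T).
      by rewrite trmx_mul trmxK mulmxA -(mulmxA x) (mulmx1C SS) mulmx1.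
    by rewrite mxE; apply: eq_bigr => i _; rewrite mxE expr2.
  have := quad_diag S d x^T x^T; rewrite trmxK => ->.
  by rewrite mulr_sumr -sumrB; apply: eq_bigr => i _; ring.
have [P [a [PP EA]]] := sym_spectral sA; have [Q [b [QQ EB]]] := sym_spectral sB.
subst A B.
have psd (M : 'M[R]_n) : psdmx M -> 0 <= (x *m M *m x^T) 0 0.
  by move=> [_ /(_ x^T)]; rewrite trmxK.
have {AC} [i ai] : exists i, a 0 i <= c.
  apply/existsP; apply: contraT; rewrite negb_exists => /forallP H.
  have := psd _ AC; rewrite mulmxBr mulmxBl mxE [X in _ + X]mxE formC subr_ge0.
  rewrite -subr_le0 (form _ _ PP); rewrite le_eqVlt ltNge.
  rewrite sumr_ge0 /= => [|k _]; last first.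
    by rewrite mulr_ge0 ?sqr_ge0 // subr_ge0 ltW // ltNge H.
  rewrite orbF psumr_eq0 => [|k _]; last first.
    by rewrite mulr_ge0 ?sqr_ge0 // subr_ge0 ltW // ltNge H.
  move=> /allP Z; exfalso; move: x0; suff -> : x = 0 by rewrite eqxx.
  have : P *m x^T = 0.
    apply/matrixP => k j; rewrite ord1 [RHS]mxE; have := Z k (mem_index_enum _).
    rewrite mulf_eq0 sqrf_eq0 subr_eq0 => /orP [/eqP E|/eqP //].
    by have := H k; rewrite E lexx.
  move=> /(congr1 (mulmx P^T)); rewrite mulmxA (mulmx1C PP) mul1mx mulmx0.
  by move=> /(congr1 trmx); rewrite trmxK trmx0.
have {CB} [j bj] : exists j, c <= b 0 j.
  apply/existsP; apply: contraT; rewrite negb_exists => /forallP H.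
  have := psd _ CB; rewrite mulmxBr mulmxBl mxE [X in _ + X]mxE formC.
  rewrite (form _ _ QQ) le_eqVlt ltNge.
  rewrite sumr_le0 /= => [|k _]; last first.
    by rewrite mulr_le0_ge0 ?sqr_ge0 // subr_le0 ltW // ltNge H.
  rewrite orbF eq_sym -oppr_eq0 -sumrN psumr_eq0 => [|k _]; last first.
    by rewrite oppr_ge0 mulr_le0_ge0 ?sqr_ge0 // subr_le0 ltW // ltNge H.
  move=> /allP Z; exfalso; move: x0; suff -> : x = 0 by rewrite eqxx.
  have : Q *m x^T = 0.
    apply/matrixP => k j; rewrite ord1 [RHS]mxE; have := Z k (mem_index_enum _).
    rewrite oppr_eq0 mulf_eq0 sqrf_eq0 subr_eq0 => /orP [/eqP E|/eqP //].
    by have := H k; rewrite E lexx.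
  move=> /(congr1 (mulmx Q^T)); rewrite mulmxA (mulmx1C QQ) mul1mx mulmx0.
  by move=> /(congr1 trmx); rewrite trmxK trmx0.
apply: (iV (a 0 i) (b 0 j)); last by rewrite ai.
  by apply: VA; apply/(eigenvalue_diag _ _ PP); exists i.
by apply: VB; apply/(eigenvalue_diag _ _ QQ); exists j.
Qed.

End MatrixFunction.

(** * Quadratic forms of [g(B) - g(A)] as weighted sums over eigenvalues *)

Section RankOneNodes.
Variable R : realType.

(* [x^T (g(B) - g(A)) x] as a weighted sum of values of [g], for
   [A = P^T diag(a) P] and [B = Q^T diag(b) Q]. *)
Definition form_nodes n (P Q : 'M[R]_n) (a b : 'rV[R]_n) (x : 'cV[R]_n) :
    seq (R * R) :=
  [seq (b 0 i, (Q *m x) i 0 * (Q *m x) i 0) | i <- enum 'I_n] ++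
  [seq (a 0 i, - ((P *m x) i 0 * (P *m x) i 0)) | i <- enum 'I_n].

Lemma size_form_nodes n (P Q : 'M[R]_n) a b x :
  size (form_nodes P Q a b x) = (2 * n)%N.
Proof. by rewrite size_cat !size_map -enumT size_enum_ord addnn mul2n. Qed.

Lemma map_fst_form_nodes n (P Q : 'M[R]_n) a b x :
  map fst (form_nodes P Q a b x)
  = [seq b 0 i | i <- enum 'I_n] ++ [seq a 0 i | i <- enum 'I_n].
Proof. by rewrite map_cat -!map_comp. Qed.

Lemma weighted_sum_form_nodes n (P Q : 'M[R]_n) a b x (g : R -> R) :
  weighted_sum (form_nodes P Q a b x) g =
  (x^T *m (Q^T *m diag_mx (map_mx g b) *m Q
           - P^T *m diag_mx (map_mx g a) *m P) *m x) 0 0.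
Proof.
rewrite mulmxBr mulmxBl [RHS]mxE [X in _ + X]mxE !quad_diag.
rewrite /weighted_sum big_cat !big_map -!enumT !big_enum /= -sumrN.
congr (_ + _); apply: eq_bigr => i _; rewrite [map_mx _ _ _ _]mxE; ring.
Qed.

Lemma weight_poly_form_nodes n (P Q : 'M[R]_n) (a b : 'rV[R]_n) (v x : 'cV[R]_n) :
  P *m P^T = 1%:M -> Q *m Q^T = 1%:M ->
  Q^T *m diag_mx b *m Q = P^T *m diag_mx a *m P + v *m v^T ->
  weight_poly (form_nodes P Q a b x)
  = (\sum_i ((P *m x) i 0 * (P *m v) i 0) *:
            \prod_(l | l != i) ('X - (a 0 l)%:P)) ^+ 2.
Proof.
move=> PP QQ BA; have BA1 : Q^T *m diag_mx b *m Q = P^T *m diag_mx a *m P + 1 *: (v *m v^T).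
  by rewrite scale1r.
rewrite -[RHS]scale1r -(rank1_form PP QQ BA1 x).
rewrite weight_poly_cat !node_poly_ord !weight_poly_ord; congr (_ + _).
by rewrite -mulrN -sumrN; congr (_ * _); apply: eq_bigr => i _; rewrite scaleNr.
Qed.

Lemma size_prod_neq n (a : 'rV[R]_n) (w : 'I_n -> R) :
  (size (\sum_i w i *: \prod_(l | l != i) ('X - (a 0 l)%:P) : {poly R})%R <= n)%N.
Proof.
apply: (leq_trans (size_sum _ _ _)); apply/bigmax_leqP => i _.
apply: (leq_trans (size_scale_leq _ _)).
rewrite -big_filter -(big_map (a 0) xpredT (fun s => 'X - s%:P)) size_prod_XsubC.
rewrite size_map size_filter -sum1_count big_mkcond /=.
have n0 : (0 < n)%N by case: n i {a w} => [[]|].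
have := cardC1 i; rewrite card_ord -sum1_card => E.
rewrite -big_mkcond /= -[X in (_ <= X)%N](prednK n0) -E ltnS leq_eqVlt.
by apply/orP; left; apply/eqP; apply: eq_bigl.
Qed.

End RankOneNodes.

(** * Matrix monotonicity and Hankel forms *)

Lemma mxfun_sym (R : realType) (f : R -> R) n (A : 'M[R]_n) :
  A^T = A -> (mxfun f A)^T = mxfun f A.
Proof.
by move=> /sym_spectral [P [d [PP ->]]]; rewrite mxfun_diag // conj_diag_sym.
Qed.

Lemma loewner_le_rank1 (R : realType) (V : set R) n (f : R -> R) (A : 'M[R]_n)
    (v : 'cV[R]_n) :
  open V -> is_interval V -> nderivable_on V (2 * n).-1 f ->
  (forall x, V x -> hankel_psd (jet f (2 * n).-1 x) n) ->
  A^T = A -> spectrum_in V A -> spectrum_in V (A + v *m v^T) ->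
  loewner_le (mxfun f A) (mxfun f (A + v *m v^T)).
Proof.
move=> oV iV nf hf sA VA VB.
have sB : (A + v *m v^T)^T = A + v *m v^T by rewrite linearD /= sA (psdmx_outer v).1.
split; first by rewrite linearB /= !mxfun_sym.
have [P [a [PP EA]]] := sym_spectral sA; have [Q [b [QQ EB]]] := sym_spectral sB.
move=> x; rewrite {1}EB {1}EA !mxfun_diag // -weighted_sum_form_nodes.
apply: (weighted_sum_ge0 oV iV nf hf (size_form_nodes _ _ _ _ _) _
         (weight_poly_form_nodes x PP QQ _)); first exact: size_prod_neq.
  by rewrite -EB {1}EA.
move=> s; rewrite map_fst_form_nodes mem_cat => /orP [] /mapP [i _ ->].
  by apply: VB; rewrite EB; apply/(eigenvalue_diag _ _ QQ); exists i.
by apply: VA; rewrite EA; apply/(eigenvalue_diag _ _ PP); exists i.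
Qed.

Lemma mx_monotone_of_hankel (R : realType) (V : set R) n (f : R -> R) :
  open V -> is_interval V -> nderivable_on V (2 * n).-1 f ->
  (forall x, V x -> hankel_psd (jet f (2 * n).-1 x) n) ->
  mx_monotone V n f.
Proof.
move=> oV iV nf hf A B sA sB VA VB AB.
have [vs Evs] := psdmx_sum_outer AB.
have EB : B = A + \sum_(v <- vs) v *m v^T by rewrite -Evs addrC subrK.
elim: vs A sA VA EB {AB Evs} => [|v vs IH] A sA VA EB.
  rewrite EB big_nil addr0 /loewner_le subrr; split=> [|x]; first exact: trmx0.
  by rewrite mulmx0 mul0mx mxE.
pose C := A + v *m v^T.
have BC : B = C + \sum_(v <- vs) v *m v^T by rewrite EB big_cons addrA.
have sC : C^T = C by rewrite linearD /= sA (psdmx_outer v).1.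
have VC : spectrum_in V C.
  apply: (spectrum_between iV sA sB VA VB).
    by rewrite /loewner_le /C addrAC subrr add0r; exact: psdmx_outer.
  by rewrite /loewner_le BC addrAC subrr add0r; exact: psdmx_sum.
have := psdmxD (IH C sC VC BC) (loewner_le_rank1 oV iV nf hf sA VA VC).
by rewrite addrA subrK.
Qed.

Lemma poly_bound01 (R : realType) (q : {poly R}) :
  exists2 M, 0 <= M & forall t, 0 <= t <= 1 -> `|q.[t]| <= M.
Proof.
exists (\sum_(i < size q) `|q`_i|); first by apply: sumr_ge0.
move=> t /andP [t0 t1]; rewrite horner_coef.
apply: (le_trans (ler_norm_sum _ _ _)); apply: ler_sum => i _.
by rewrite normrM ler_piMr // normrX ger0_norm // exprn_ile1.
Qed.

Lemma weighted_sum_norm_le (R : realType) (L : seq (R * R)) (g : R -> R) (C e : R) :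
  0 <= C -> (forall x, x \in L -> `|x.2| <= C /\ `|g x.1| <= e) ->
  `|weighted_sum L g| <= (size L)%:R * (C * e).
Proof.
move=> C0; elim: L => [|x L IH] H.
  by rewrite /weighted_sum big_nil normr0 mul0r.
rewrite weighted_sum_cons /= -natr1 mulrDl mul1r addrC.
apply: (le_trans (ler_normD _ _)); apply: lerD.
  by apply: IH => y yL; apply: H; rewrite inE yL orbT.
by have [? ?] := H x (mem_head _ _); rewrite normrM ler_pM.
Qed.

(* Along nodes [x + t * s] only the coefficient of [t ^+ N] survives: the
   lower powers of ['X] reduce modulo the node polynomial to degree [< N]. *)
Lemma weighted_sum_scaled (R : realType) (L : seq (R * R)) (N : nat) (P T : {poly R})
    (t : R) :
  size L = N.+1 -> weight_poly L = (P \Po (t *: 'X)) ^+ 2 ->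
  weighted_sum L (horner (T \Po (t *: 'X)))
  = t ^+ N * ((P ^+ 2 * T)`_N
      + t * \sum_(i < size (P ^+ 2 * T)) (if (N < i)%N then
          (P ^+ 2 * T)`_i * ('X^i %% node_poly L)`_N * t ^+ (i - N.+1) else 0)).
Proof.
move=> sL EL; rewrite coef_weight_poly_mod EL sL /=.
rewrite !expr2 -!comp_polyM -expr2; set G := P ^+ 2 * T.
have -> : ((G \Po (t *: 'X)) %% node_poly L)`_N
    = \sum_(i < size G) G`_i * t ^+ i * ('X^i %% node_poly L)`_N.
  rewrite comp_polyE (big_morph _ (modpD _) (mod0p _)) coef_sum.
  by apply: eq_bigr => i _; rewrite exprZn scalerA modpZl coefZ.
have [sG|sG] := leqP (size G) N.
  rewrite !big1 ?(nth_default 0 sG) ?mulr0 ?addr0 ?mulr0 // => i _.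
    by rewrite ltnNge ltnW // (leq_trans (ltn_ord i) sG).
  rewrite modp_small ?coefXn; last by rewrite size_polyXn size_node_poly sL; have := ltn_ord i; lia.
  by rewrite gtn_eqF ?mulr0 // (leq_trans (ltn_ord i) sG).
rewrite mulrDr mulrA mulr_sumr (bigD1 (Ordinal sG)) //=.
congr (_ + _).
  rewrite modp_small ?coefXn ?eqxx; first by rewrite mulr1 mulrC.
  by rewrite size_polyXn size_node_poly sL.
rewrite [RHS](bigD1 (Ordinal sG)) //= ltnn mulr0 add0r.
apply: eq_bigr => i; rewrite -(inj_eq val_inj) /= => iN.
case: (ltngtP i N) iN => // [iN|Ni] _.
  rewrite modp_small ?coefXn; last by rewrite size_polyXn size_node_poly sL !ltnS ltnW.
  by rewrite gtn_eqF // !mulr0.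
have -> : t ^+ i = t ^+ N * t * t ^+ (i - N.+1).
  by rewrite -exprSr -exprD subnKC.
by ring.
Qed.

Lemma hankel_of_mx_monotone (R : realType) (V : set R) m (f : R -> R) :
  open V -> nderivable_on V (2 * m.+1).-1 f -> mx_monotone V m.+1 f ->
  forall x, V x -> hankel_psd (jet f (2 * m.+1).-1 x) m.+1.
Proof.
move=> oV nf mono x Vx p sp; set n := m.+1; pose N := (2 * m).+1.
have EN : (2 * n).-1 = N by rewrite /n /N; lia.
rewrite EN in nf *; set T := jet f N x.
(* The entries of [a] are distinct and those of [v] nonzero, so every polynomial of degree at most
   [m] occurs as the square root in [weight_poly_form_nodes]. *)
pose a : 'rV[R]_n := \row_i (i : nat)%:R; pose v : 'cV[R]_n := const_mx 1.
have sA : (diag_mx a)^T = diag_mx a by rewrite tr_diag_mx.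
have sB : (diag_mx a + v *m v^T)^T = diag_mx a + v *m v^T.
  by rewrite linearD /= sA (psdmx_outer v).1.
have [Q [b [QQ EB]]] := sym_spectral sB.
have II : (1%:M : 'M[R]_n) *m 1%:M^T = 1%:M by rewrite trmx1 mulmx1.
have IA (d : 'rV[R]_n) : 1%:M^T *m diag_mx d *m 1%:M = diag_mx d.
  by rewrite trmx1 mul1mx mulmx1.
pose D i := \prod_(l < n | l != i) (a 0 i - a 0 l).
have inj_a i l : l != i -> a 0 i - a 0 l != 0.
  by move=> li; rewrite !mxE subr_eq0 eqr_nat eq_sym (inj_eq val_inj).
have D0 i : D i != 0 by apply/prodf_neq0 => l; exact: inj_a.
(* Lagrange coefficients at the nodes [a], chosen so that this square root is [p \Po (t *: 'X)]. *)
pose y (t : R) : 'cV[R]_n := \col_i (p.[t * a 0 i] / D i).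
pose L t := form_nodes 1%:M Q a b (y t).
have sL t : size (L t) = N.+1 by rewrite size_form_nodes /n /N; lia.
have EL t : weight_poly (L t) = (p \Po (t *: 'X)) ^+ 2.
  rewrite (weight_poly_form_nodes (v := v) _ II QQ); last by rewrite -EB IA.
  congr (_ ^+ 2); rewrite mul1mx mul1mx.
  set s := \sum_i _.
  have ss : (size s <= n)%N by exact: size_prod_neq.
  have sq : (size (p \Po (t *: 'X)) <= n)%N.
    have [->|t0] := eqVneq t 0.
      by rewrite scale0r comp_poly0r (leq_trans (size_polyC_leq1 _)).
    by rewrite size_comp_poly2 // size_scale // size_polyX.
  apply/eqP; rewrite -subr_eq0; apply: contraT => d0.
  have := @max_poly_roots _ _ [seq a 0 i | i <- index_enum 'I_n] d0.
  have -> : size [seq a 0 i | i <- index_enum 'I_n] = n.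
    by rewrite size_map -[RHS](card_ord n) cardT enumT.
  move=> H; have : (n < size (s - (p \Po (t *: 'X)))%R)%N.
    apply: H; last first.
      rewrite map_inj_uniq ?index_enum_uniq // => i l; rewrite !mxE => /eqP.
      by rewrite eqr_nat => /eqP /val_inj.
    apply/allP => _ /mapP [i _ ->]; rewrite /root hornerD hornerN horner_comp hornerZ hornerX.
    rewrite /s horner_sum (bigD1 i) //= [X in _ + X - _]big1 => [|l li].
      rewrite hornerZ horner_prod addr0 !mxE mulr1.
      under eq_bigr do rewrite hornerXsubC.
      have := D0 i; rewrite /D !mxE => ?; rewrite divfK // subrr //.
    rewrite hornerZ horner_prod (bigD1 i) //=; last by rewrite eq_sym.
    by rewrite hornerXsubC subrr mul0r mulr0.
  rewrite ltnNge; move=> /negP [].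
  by apply: (leq_trans (size_polyD _ _)); rewrite size_polyN geq_max ss sq.
have /nbhs_ballP [d0 /= d00 d0V] : nbhs x V by exact: open_nbhs_nbhs.
pose S : R := \sum_i `|b 0 i| + \sum_i `|a 0 i| + 1.
have S0 : 0 < S by rewrite ltr_wpDl // addr_ge0 // sumr_ge0.
have Sb i : `|b 0 i| <= S.
  rewrite /S (bigD1 i) //= -!addrA lerDl !addr_ge0 // sumr_ge0 //.
have Sa i : `|a 0 i| <= S.
  rewrite /S -addrA addrC (bigD1 i) //= -!addrA lerDl !addr_ge0 // sumr_ge0 //.
have nodeP (t s : R) : s \in map fst (L t) -> `|s| <= S.
  by rewrite map_fst_form_nodes mem_cat => /orP [] /mapP [i _ ->].
(* Monotonicity for the pair [x + t A <= x + t B], whose spectra lie within [t * S] of [x], tested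
   on [y t]. *)
have pos (t : R) : 0 < t -> t * S < d0 -> 0 <= weighted_sum (L t) (fun s => f (x + t * s)).
  move=> t0 tS.
  pose sc (d : 'rV[R]_n) : 'rV[R]_n := map_mx (fun s => x + t * s) d.
  have Esc (P : 'M[R]_n) (d : 'rV[R]_n) : P *m P^T = 1%:M ->
      P^T *m diag_mx (sc d) *m P = x%:M + t *: (P^T *m diag_mx d *m P).
    move=> PP; have -> : diag_mx (sc d) = x%:M + t *: diag_mx d.
      by apply/matrixP => i j; rewrite !mxE mulrnDl mulrnAr.
    rewrite mulmxDr mulmxDl mul_mx_scalar -scalemxAl (mulmx1C PP) scalemx1.
    by rewrite -scalemxAr -scalemxAl.
  have Vsc (P : 'M[R]_n) (d : 'rV[R]_n) : P *m P^T = 1%:M -> (forall i, `|d 0 i| <= S) ->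
      spectrum_in V (P^T *m diag_mx (sc d) *m P).
    move=> PP dS c /(eigenvalue_diag _ _ PP) [i ->]; apply: d0V.
    rewrite mxE /ball /= opprD addrA subrr add0r normrN normrM gtr0_norm //.
    by apply: le_lt_trans tS; rewrite ler_pM2l.
  have := mono (1%:M^T *m diag_mx (sc a) *m 1%:M) (Q^T *m diag_mx (sc b) *m Q).
  case.
  - exact: conj_diag_sym.
  - exact: conj_diag_sym.
  - exact: Vsc.
  - exact: Vsc.
  - rewrite /loewner_le !Esc // -EB IA opprD addrACA subrr add0r -scalerBr.
    rewrite addrAC subrr add0r; have [ss ps] := psdmx_outer v.
    split=> [|u]; first by rewrite linearZ /= ss.
    by rewrite -scalemxAr -scalemxAl mxE; apply: mulr_ge0; [exact: ltW|exact: ps].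
  move=> _ /(_ (y t)); rewrite !mxfun_diag //.
  rewrite weighted_sum_form_nodes.
  by rewrite -!map_mx_comp.
set H := (p ^+ 2 * T)`_N.
(* The node polynomial does not depend on [t], so everything beyond [H] is [t] times a sum bounded
   uniformly on [0 < t <= 1]. *)
have [K K0 KP] : exists2 K : R, 0 <= K & forall t : R, 0 < t <= 1 ->
    weighted_sum (L t) (horner (T \Po (t *: 'X))) <= t ^+ N * (H + t * K).
  pose rho i := ('X^i %% node_poly (L 0))`_N.
  exists (\sum_(i < size (p ^+ 2 * T)) `|(p ^+ 2 * T)`_i * rho i|).
    by apply: sumr_ge0.
  move=> t /andP [t0 t1]; rewrite (weighted_sum_scaled _ (sL t) (EL t)).
  have -> : node_poly (L t) = node_poly (L 0).
    by rewrite !node_poly_cat !node_poly_ord.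
  apply: ler_wpM2l; first by rewrite exprn_ge0 ?ltW.
  rewrite lerD2l; apply: ler_wpM2l; first exact: ltW.
  apply: ler_sum => i _; case: ifP => // _.
  apply: le_trans (ler_norm _) _; rewrite normrM ler_piMr //.
  by rewrite normrX gtr0_norm // exprn_ile1 // ltW.
(* The weights depend on [t] only through [y t], whose entries are polynomials in [t]; hence a
   uniform bound. *)
have [C C0 CP] : exists2 C : R, 0 <= C & forall t : R, 0 < t <= 1 ->
    forall k, k \in L t -> `|k.2| <= C.
  have /choice [M MP] : forall i : 'I_n, exists M : R, 0 <= M /\
      forall t : R, 0 < t <= 1 -> `|y t i 0| <= M.
    move=> i; have [M M0 MP] := poly_bound01 ((D i)^-1 *: (p \Po (a 0 i *: 'X))).
    exists M; split=> // t /andP [t0 t1]; have := MP t.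
    rewrite ltW //= t1 => /(_ isT).
    rewrite hornerZ horner_comp hornerZ hornerX [y t i 0]mxE.
    by rewrite (mulrC (a 0 i) t) (mulrC _ (D i)^-1).
  pose G1 := \sum_j \sum_i `|Q j i| * M i; pose G2 := \sum_i M i.
  have M0 i : 0 <= M i by have [] := MP i.
  have G10 : 0 <= G1 by apply: sumr_ge0 => j _; apply: sumr_ge0 => i _; rewrite mulr_ge0.
  have G20 : 0 <= G2 by apply: sumr_ge0.
  exists (G1 * G1 + G2 * G2); first by rewrite addr_ge0 // mulr_ge0.
  move=> t tI k; rewrite mem_cat => /orP [] /mapP [i _ ->] /=.
    have H1 : `|(Q *m y t) i 0| <= G1.
      rewrite mxE (le_trans (ler_norm_sum _ _ _)) // /G1 [leRHS](bigD1 i) //=.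
      rewrite -[leLHS]addr0 lerD //; last first.
        by apply: sumr_ge0 => j _; apply: sumr_ge0 => l _; rewrite mulr_ge0.
      apply: ler_sum => j _; rewrite normrM ler_wpM2l //.
      by have [_] := MP j; apply.
    rewrite normrM (le_trans (ler_pM _ _ H1 H1)) // lerDl mulr_ge0 //.
  have H2 : `|((1%:M : 'M[R]_n) *m y t) i 0| <= G2.
    rewrite mul1mx /G2 (bigD1 i) //= -[leLHS]addr0 lerD //; last exact: sumr_ge0.
    by have [_] := MP i; apply.
  by rewrite normrN normrM (le_trans (ler_pM _ _ H2 H2)) // lerDr mulr_ge0.
rewrite leNgt; apply/negP => H0; rewrite -/H in H0.
(* Error budget for negative [H]: [e] keeps the Taylor remainders below [t ^+ N * (- H / 4)] in
   total, and the last bound in [t] keeps [t * K] below [- H / 4]. The sum is then at most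
   [t ^+ N * (H / 2)], contradicting [pos]. The added ones make the denominators positive. *)
pose cc : R := N.+1%:R * (C * S ^+ N) + 1.
have cc0 : 0 < cc by rewrite ltr_wpDl // !mulr_ge0 // exprn_ge0 // ltW.
pose e := - H / (4 * cc).
have e0 : 0 < e by rewrite divr_gt0 ?oppr_gt0 // mulr_gt0.
have [d1 d10 d1P] := taylor_peano oV Vx nf e0.
(* The bounds with [2 * S] put [t * S] strictly inside the radius [d0] of a ball in [V] and the
   radius [d1] of the Taylor estimate. *)
pose t := Num.min (Num.min 1 (d0 / (2 * S)))
  (Num.min (d1 / (2 * S)) (- H / (4 * (K + 1)))).
have K1 : 0 < K + 1 by rewrite ltr_wpDl.
have t0 : 0 < t.
  by rewrite !lt_min ltr01 !divr_gt0 ?mulr_gt0 ?oppr_gt0.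
have : t <= t by []; rewrite {2}/t !le_min => /andP [/andP [t1 td0] /andP [td1 tK]].
have halfS u : 0 < u -> t <= u / (2 * S) -> t * S < u.
  move=> u0 tu; apply: le_lt_trans (_ : u / 2 < u); last by lra.
  have -> : u / 2 = u / (2 * S) * S by field; rewrite gt_eqF.
  by rewrite ler_pM2r.
have tN : 0 < t ^+ N by rewrite exprn_gt0.
have := pos t t0 (halfS _ d00 td0).
pose r s := f (x + t * s) - T.[t * s].
have -> : weighted_sum (L t) (fun s => f (x + t * s))
    = weighted_sum (L t) (horner (T \Po (t *: 'X))) + weighted_sum (L t) r.
  rewrite /weighted_sum -big_split /=; apply: eq_bigr => k _.
  by rewrite /r horner_comp hornerZ hornerX; ring.
apply/negP; rewrite -ltNge.
have tI : 0 < t <= 1 by rewrite t0.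
have Br : `|weighted_sum (L t) r| <= N.+1%:R * (C * (e * (t * S) ^+ N)).
  rewrite -(sL t); apply: weighted_sum_norm_le => // k kL; split; first exact: CP kL.
  have ks : `|t * k.1| <= t * S.
    by rewrite normrM gtr0_norm // ler_pM2l // (nodeP t) // (map_f fst).
  apply: le_trans (d1P _ _) _; first exact: le_lt_trans ks (halfS _ d10 td1).
  by apply: ler_wpM2l (ltW e0) _ _ _; apply: lerXn2r => //; rewrite nnegrE // mulr_ge0 // ltW.
have Br' : N.+1%:R * (C * (e * (t * S) ^+ N)) <= t ^+ N * (- H / 4).
  have -> : N.+1%:R * (C * (e * (t * S) ^+ N)) = t ^+ N * ((cc - 1) * e).
    by rewrite /cc exprMn; ring.
  rewrite ler_pM2l // /e; have -> : - H / 4 = cc * (- H / (4 * cc)) by field; rewrite gt_eqF.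
  by rewrite -/e ler_pM2r // gerBl.
have Bk : t ^+ N * (H + t * K) <= t ^+ N * (H + - H / 4).
  rewrite ler_pM2l // lerD2l.
  apply: (@le_trans _ _ (t * (K + 1))); first by rewrite ler_pM2l // lerDl.
  have -> : - H / 4 = - H / (4 * (K + 1)) * (K + 1) by field; rewrite gt_eqF.
  by rewrite ler_pM2r.
have := KP t tI; have := ler_norm (weighted_sum (L t) r).
have : t ^+ N * (H + - H / 4) + t ^+ N * (- H / 4) < 0.
  rewrite -mulrDr pmulr_rlt0 //; lra.
move: Br Br' Bk; lra.
Qed.

(** * Pade approximants and Hankel forms *)

Section PadeAlgebra.
Variable R : realType.
Implicit Types (F p q : {poly R}) (k n : nat).

Lemma coefM_low p (E : {poly R}) n : (forall i, (i < n)%N -> E`_i = 0) ->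
  (p * E)`_n = p`_0 * E`_n.
Proof.
move=> En; rewrite coefM (bigD1 ord0) //= subn0 big1 ?addr0 // => i.
rewrite -(inj_eq val_inj) /= => i0.
by rewrite En ?mulr0 //=; have := ltn_ord i; lia.
Qed.

Lemma coefM_size p q n : (size p + size q <= n.+1)%N -> (p * q)`_n = 0.
Proof. by move=> s; rewrite nth_default // (leq_trans (size_polyMleq _ _)) //; lia. Qed.

Section Pair.
Variables (F p q : {poly R}) (k : nat).
Hypotheses (sp : (size p <= k.+1)%N) (sq : (size q <= k.+1)%N).
Hypothesis FqE : eqmodX (2 * k).+1 (F * q) p.

Lemma pade_error_low i : (i < (2 * k).+1)%N -> (F * q - p)`_i = 0.
Proof. by move=> ik; rewrite coefB FqE ?subrr. Qed.

(** In [q^2 F = q p + q (F q - p)] the first term has degree at most [2k], while the error in the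
    second starts at degree [2k+1]. *)
Lemma pade_hankel_den : (q ^+ 2 * F)`_(2 * k).+1 = q`_0 * (F * q - p)`_(2 * k).+1.
Proof.
have -> : q ^+ 2 * F = q * p + q * (F * q - p) by ring.
rewrite coefD (coefM_low _ pade_error_low) coefM_size ?add0r //.
by apply: (leq_trans (leq_add sq sp)); lia.
Qed.

(** The splitting [P = a q + X p1] is orthogonal for the form: its cross term is the coefficient of
    index [2k] in [p1 (F q - p) + p1 p], where the error has not started and [p1 p] has already
    ended. *)
Lemma hankel_psd_step : q`_0 != 0 -> 0 <= q`_0 * (F * q - p)`_(2 * k).+1 ->
  hankel_psd F k -> hankel_psd F k.+1.
Proof.
move=> q0 c0 hF P sP.
pose a := P`_0 / q`_0.
have /factor_theorem [p1 E1] : root (P - a *: q) 0.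
  by rewrite /root horner_coef0 coefB coefZ /a divfK ?subrr.
rewrite subr0 in E1.
have sp1 : (size p1 <= k)%N.
  have [->|p10] := eqVneq p1 0; first by rewrite size_poly0.
  rewrite -ltnS -(size_mulX p10) -E1 (leq_trans (size_polyD _ _)) //.
  by rewrite geq_max sP size_polyN (leq_trans (size_scale_leq _ _)).
have -> : (2 * k.+1).-1 = (2 * k).+1 by lia.
have -> : P ^+ 2 * F = (a ^+ 2) *: (q ^+ 2 * F) + (2 * a) *: (p1 * (F * q - p) + p1 * p) * 'X
     + p1 ^+ 2 * F * 'X * 'X.
  by rewrite -[P](subrK (a *: q)) E1 -!mul_polyC polyC_exp polyCM polyC_natr; ring.
have Z1 : (p1 * (F * q - p))`_(2 * k) = 0.
  rewrite coefM_low; last by move=> i ik; rewrite pade_error_low // ltnW.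
  by rewrite pade_error_low // mulr0.
have Z2 : (p1 * p)`_(2 * k) = 0.
  by apply: coefM_size; apply: (leq_trans (leq_add sp1 sp)); lia.
rewrite !coefD coefZ pade_hankel_den !coefMX /= coefZ (coefD (p1 * _)) Z1 Z2 addr0 mulr0 addr0.
apply: addr_ge0; first by rewrite mulr_ge0 ?sqr_ge0.
by case: ifP => // _; exact: hF.
Qed.

End Pair.

(** For small [t] of sign opposite to [B] the linear term would win. This is the step from isotropic
    vector to kernel vector of a semi-definite form. *)
Lemma linear_coef_eq0 (B C : R) : (forall t, 0 <= 2 * t * B + t ^+ 2 * C) -> B = 0.
Proof.
move=> H; apply/eqP; apply: contraT => B0.
have c0 : 0 < `|C| + 1 by rewrite ltr_wpDl.
have := H (- B / (`|C| + 1)).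
have -> : 2 * (- B / (`|C| + 1)) * B + (- B / (`|C| + 1)) ^+ 2 * C
   = (B / (`|C| + 1)) ^+ 2 * (C - 2 * (`|C| + 1)).
  by field; rewrite gt_eqF.
rewrite pmulr_rge0; last by rewrite exprn_even_gt0 //= mulf_neq0 // invr_eq0 gt_eqF.
have := ler_norm C; have := normr_ge0 C; lra.
Qed.

(** There are [k] linear equations for [k.+1] coefficients, so a nonzero solution exists; the point
    is its constant term. A solution divisible by ['X] stays a solution after division, and dividing
    as long as possible reaches a nonzero constant term. *)
Lemma pade_denominator_exists F k : (0 < k)%N -> hankel_psd F k.+1 ->
  exists q, [/\ (size q <= k.+1)%N, q`_0 != 0 &
    forall j, (k < j)%N -> (j <= 2 * k)%N -> (F * q)`_j = 0].
Proof.
move=> k0 hF.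
pose sol q := (size q <= k.+1)%N /\
  (forall j, (k < j)%N -> (j <= 2 * k)%N -> (F * q)`_j = 0).
have sol_divX q1 : sol (q1 * 'X) -> sol q1.
  move=> [sq qP]; have [->|q10] := eqVneq q1 0.
    by split=> [|j]; rewrite ?size_poly0 // mulr0 coef0.
  rewrite size_mulX // ltnS in sq; split; first exact: leqW.
  have H j : (k <= j)%N -> (j < 2 * k)%N -> (F * q1)`_j = 0.
    by move=> kj j2; have := qP j.+1; rewrite mulrA coefMX /=; apply.
  move=> j kj; rewrite leq_eqVlt => /orP [/eqP ->|]; last by apply: H; exact: ltnW.
  (* The equation of index [2 * k] is the only one not inherited from [q1 * 'X]. That polynomial is
     isotropic, so the form at [q1 * 'X + t] has no constant term in [t]. *)
  apply: (@linear_coef_eq0 _ F`_(2 * k).+1) => t.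
  have := hF (q1 * 'X + t%:P).
  have -> : (2 * k.+1).-1 = (2 * k).+1 by lia.
  have -> : (q1 * 'X + t%:P) ^+ 2 * F
      = q1 * (F * q1) * 'X * 'X + (2 * t) *: (F * q1 * 'X) + (t ^+ 2) *: F.
    by rewrite -!mul_polyC polyC_exp polyCM polyC_natr; ring.
  rewrite !coefD !coefZ !coefMX /=.
  have -> : (2 * k == 0)%N = false by lia.
  have -> : (q1 * (F * q1))`_(2 * k).-1 = 0.
    rewrite coefM big1 // => -[i /= ilt] _.
    have [ik|ki] := ltnP i k; first by rewrite H ?mulr0 //; lia.
    by rewrite [q1`_i]nth_default ?mul0r // (leq_trans sq).
  rewrite add0r; apply.
  rewrite (leq_trans (size_polyD _ _)) // geq_max size_mulX // ltnS sq.
  by rewrite (leq_trans (size_polyC_leq1 _)).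
have reduce n q : (size q <= n)%N -> q != 0 -> sol q -> exists q' : {poly R}, q'`_0 != 0 /\ sol q'.
  elim: n q => [|n IH] q sq qn solq.
    by move: qn; rewrite -size_poly_gt0; lia.
  have [q0|q0] := eqVneq q`_0 0; last by exists q; split.
  have /factor_theorem [q1 E1] : root q 0 by rewrite /root horner_coef0 q0.
  rewrite subr0 in E1; have q1n : q1 != 0 by apply: contraNneq qn => q10; rewrite E1 q10 mul0r.
  apply: (IH q1) => //; last by apply: sol_divX; rewrite -E1.
  by rewrite -ltnS -(size_mulX q1n) -E1.
suff [q [qn solq]] : exists q, q != 0 /\ sol q.
  have [q' [q'0 [sq' q'P]]] := reduce (size q) q (leqnn _) qn solq.
  by exists q'.
pose M : 'M[R]_(k.+1, k) := \matrix_(i, j) F`_(k.+1 + j - i).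
have /rowV0Pn [v vM v0] : kermx M != 0.
  by rewrite kermx_eq0 /row_free neq_ltn (leq_ltn_trans (rank_leq_col _)).
exists (rVpoly v); split.
  by apply: contraNneq v0 => E; rewrite -[v]rVpolyK E linear0.
split; first exact: size_poly.
move=> j kj j2; have jk : (j - k.+1 < k)%N by lia.
have /sub_kermxP vM0 := vM; have := matrix_entry 0 (Ordinal jk) vM0.
rewrite [RHS]mxE mxE => E; rewrite mulrC coefM -[RHS]E.
pose g i := (rVpoly v)`_i * F`_(j - i).
transitivity (\sum_(i < k.+1) g i); last first.
  apply: eq_bigr => i _; rewrite /g coef_rVpoly_ord mxE /=.
  by congr (_ * F`_ _); lia.
rewrite [RHS](big_ord_widen j.+1 g) ?ltnS // 1?ltnW // [RHS]big_mkcond /=; apply: eq_bigr => i _.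
case: ifP => // /negbT; rewrite -leqNgt => ki.
by rewrite nth_default ?mul0r // (leq_trans (size_poly _ _)).
Qed.

Lemma eqmodX_mul_monomial (A B : {poly R}) (c : R) n : B`_0 != 0 ->
  eqmodX n.+1 (A * B) (c *: 'X^n) ->
  (forall i, (i < n)%N -> A`_i = 0) /\ A`_n = c / B`_0.
Proof.
move=> B0 AB.
have low i : (i < n)%N -> A`_i = 0.
  elim/ltn_ind: i => i IH ilt; have := AB i (ltnW ilt).
  rewrite mulrC coefM_low => [|j ji]; last by apply: IH => //; exact: ltn_trans ilt.
  rewrite coefZ coefXn ltn_eqF // mulr0 => /eqP; rewrite mulf_eq0 (negbTE B0).
  by move/eqP.
split=> //; have := AB n (leqnn _); rewrite mulrC (coefM_low _ low).
by rewrite coefZ coefXn eqxx mulr1 => <-; rewrite mulrC mulKf.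
Qed.

Lemma eqmodX_mulI (A B C : {poly R}) n : C`_0 != 0 ->
  eqmodX n (A * C) (B * C) -> eqmodX n A B.
Proof.
case: n => [//|n] C0 AC i ilt; apply/eqP; rewrite -subr_eq0 -coefB.
have [|_ ->] := @eqmodX_mul_monomial (A - B) C 0 i C0; last by rewrite mul0r.
move=> j ji; rewrite scale0r coef0 mulrBl coefB AC ?subrr //.
exact: leq_ltn_trans ilt.
Qed.

Lemma comp_poly_taylor2 p (E : {poly R}) :
  exists s, p \Po ('X + E) = p + E * p^`() + E ^+ 2 * s.
Proof.
elim/poly_ind: p => [|p c [s IH]].
  by exists 0; rewrite comp_poly0 deriv0 !mulr0 !addr0.
exists (p^`() + s * 'X + s * E).
rewrite comp_polyD comp_polyM comp_polyX comp_polyC IH derivD derivM derivX derivC.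
by ring.
Qed.

(* If [p(W) = F * q(W)] with [W = 'X + E], then linearising in [E] turns the
   Pade error [F * q - p] into [E] times the unit [F`_1 * q`_0 + ...]. *)
Lemma pade_error_inverse F p q (W : {poly R}) k : (0 < k)%N ->
  (size p <= k.+1)%N -> eqmodX (2 * k).+1 (F * q) p ->
  q`_0 != 0 -> F`_1 != 0 -> W`_0 = 0 ->
  eqmodX (2 * k).+2 (p \Po W) (F * (q \Po W)) ->
  W`_(2 * k).+1 * (F`_1 * q`_0) = (F * q - p)`_(2 * k).+1.
Proof.
move=> k0 sp Fq q0 F1 W0 pW; pose E := W - 'X.
have [s1 Es1] := comp_poly_taylor2 p E; have [s2 Es2] := comp_poly_taylor2 q E.
have WE : 'X + E = W by rewrite /E addrC subrK.
rewrite WE in Es1 Es2; rewrite Es1 Es2 in pW.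
pose B := p^`() - F * q^`() + E * (s1 - F * s2).
have E0 : E`_0 = 0 by rewrite /E coefB coefX W0 subr0.
have B0 : B`_0 = F`_1 * q`_0.
  rewrite /B coefD coefB !coef0M E0 mul0r addr0 !coef_deriv !mulr1n.
  rewrite -(Fq 1%N); last by lia.
  by rewrite coefM !big_ord_recl big_ord0 /= subn0 /bump /= subnn; ring.
have EB : eqmodX (2 * k).+2 (E * B) ((F * q - p)`_(2 * k).+1 *: 'X^((2 * k).+1)).
  move=> i ilt.
  have -> : E * B = (p + E * p^`() + E ^+ 2 * s1) - F * (q + E * q^`() + E ^+ 2 * s2)
     + (F * q - p) by rewrite /B; ring.
  rewrite coefD coefB pW // subrr add0r coefZ coefXn.
  move: ilt; rewrite ltnS leq_eqVlt => /orP [/eqP ->|ilt].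
    by rewrite eqxx mulr1.
  by rewrite ltn_eqF // mulr0 coefB Fq ?subrr.
have B0n : B`_0 != 0 by rewrite B0 mulf_neq0.
have [_] := eqmodX_mul_monomial B0n EB.
rewrite /E coefB coefX (_ : (2 * k).+1 == 1%N = false) ?subr0; last by lia.
by move=> ->; rewrite B0 divfK // -B0.
Qed.

End PadeAlgebra.

(** * Schwarzian derivatives *)

Section RationalMaps.
Variable R : realType.
Implicit Types (r : ratmap R) (f : R -> R) (x y : R) (k n : nat) (P Q : {poly R}).

Lemma open_horner_neq0 Q : open [set x | Q.[x] != 0].
Proof.
apply: (@open_comp _ _ (horner Q) [set z | z != 0]); last exact: open_neq.
by move=> x _; exact: continuous_horner.
Qed.

(* The numerator of the derivative of [r]. *)
Definition rm_wronskian r : {poly R} :=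
  deriv (rm_num r) * rm_den r - rm_num r * deriv (rm_den r).

Lemma is_derive_ratmap r x : (rm_den r).[x] != 0 ->
  is_derive x 1 (r : R -> R) ((rm_wronskian r).[x] / (rm_den r).[x] ^+ 2).
Proof.
move=> Q0; have DP := is_derive_poly (rm_num r) x.
have DQ := is_derive_poly (rm_den r) x; have DV := is_deriveV Q0 DQ.
have := is_deriveM DP DV.
have -> : (rm_num r).[x] *: (- (rm_den r).[x] ^- 2 *: ((rm_den r)^`()).[x])
    + (rm_den r).[x]^-1 *: ((rm_num r)^`()).[x]
    = (rm_wronskian r).[x] / (rm_den r).[x] ^+ 2 => //.
rewrite /rm_wronskian hornerD hornerN !hornerM /GRing.scale /=; field; exact: Q0.
Qed.

Lemma nderivable_on_ratmap n r :
  nderivable_on [set x | (rm_den r).[x] != 0] n (r : R -> R).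
Proof.
have oW : open [set x | (rm_den r).[x] != 0] by exact: open_horner_neq0.
have np P : nderivable_on [set x | (rm_den r).[x] != 0] n (horner P).
  exact: (nderivable_on_horner oW (@nderivable_on_id _ _ oW _)).
apply: (nderivable_onM oW (np _)); apply: (nderivable_onV oW _ (np _)).
by [].
Qed.

Definition rm_shift y P : {poly R} := P \Po ('X + y%:P).

Lemma size_rm_shift y P : size (rm_shift y P) = size P.
Proof. by rewrite size_comp_poly2 ?size_XaddC. Qed.

Lemma rm_shift0 y P : (rm_shift y P)`_0 = P.[y].
Proof. by rewrite -horner_coef0 horner_comp !hornerE. Qed.

Lemma jet_poly P n y : eqmodX n.+2 (jet (horner P) n.+1 y) (rm_shift y P).
Proof.
have oT : open (@setT R) by exact: openT.
have := @jet_horner R setT id n.+1 y P oT I (@nderivable_on_id _ _ oT _).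
by rewrite jet_id.
Qed.

Lemma jet_ratmap r n y : (rm_den r).[y] != 0 ->
  eqmodX n.+2 (jet (r : R -> R) n.+1 y * rm_shift y (rm_den r)) (rm_shift y (rm_num r)).
Proof.
move=> Q0; set W := [set x | (rm_den r).[x] != 0].
have oW : open W by exact: open_horner_neq0.
have nr : nderivable_on W n.+1 (r : R -> R) by exact: nderivable_on_ratmap.
have nQ : nderivable_on W n.+1 (horner (rm_den r)).
  exact: (nderivable_on_horner oW (@nderivable_on_id _ _ oW _)).
apply: (eqmodX_trans _ (@jet_poly _ _ _)).
rewrite -(@eq_jet _ W (fun x => (r : R -> R) x * (rm_den r).[x]) (horner (rm_num r))
  _ _ oW Q0); last first.
  by move=> x Wx; rewrite /rm_eval divfK; last exact: Wx.
apply: eqmodX_sym; apply: (eqmodX_trans (jetM oW Q0 nr nQ)).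
by apply: eqmodXM; [exact: eqmodX_refl|exact: jet_poly].
Qed.

(** Equality of derivatives becomes a congruence linear in numerator and denominator, the form used
    by the algebra of pairs; the jet may have any order from [2 * k] on. *)
Lemma pade_shift k n f y r : (0 < k)%N -> (2 * k <= n)%N -> is_pade k f y r ->
  [/\ (size (rm_shift y (rm_num r)) <= k.+1)%N, (size (rm_shift y (rm_den r)) <= k.+1)%N,
    (rm_shift y (rm_den r))`_0 != 0 &
    eqmodX (2 * k).+1 (jet f n y * rm_shift y (rm_den r)) (rm_shift y (rm_num r))].
Proof.
move=> k0 kn [deg Q0 Dr]; rewrite !size_rm_shift rm_shift0.
have : (maxn (size (rm_num r)) (size (rm_den r)) <= k.+1)%N.
  by rewrite (leq_trans (leqSpred _)) // ltnS.
rewrite geq_max => /andP [sP sQ]; split=> //.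
have E : (2 * k)%N = (2 * k).-1.+1 by lia.
apply: (eqmodX_trans _ (_ : eqmodX _ (jet (r : R -> R) (2 * k) y * rm_shift y (rm_den r)) _)).
  apply: eqmodXM; last exact: eqmodX_refl.
  by move=> i ik; rewrite !coef_jet ?Dr // (leq_trans _ kn).
by rewrite E; exact: jet_ratmap.
Qed.

(** A [ratmap] is in lowest terms, so the pair is divided by its gcd. The congruence for the reduced
    pair is multiplied back by the gcd and compared with the given one, and the unit [q] is
    cancelled. *)
Lemma pade_of_pair k n f y (p q : {poly R}) : (0 < k)%N -> (2 * k <= n)%N ->
  (size p <= k.+1)%N -> (size q <= k.+1)%N -> q`_0 != 0 ->
  eqmodX (2 * k).+1 (jet f n y * q) p -> exists r, is_pade k f y r.
Proof.
move=> k0 kn sp sq q0 Fq.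
pose P := p \Po ('X - y%:P); pose Q := q \Po ('X - y%:P).
have PE : rm_shift y P = p.
  by rewrite /rm_shift -comp_polyA comp_polyB comp_polyX comp_polyC addrK comp_polyXr.
have QE : rm_shift y Q = q.
  by rewrite /rm_shift -comp_polyA comp_polyB comp_polyX comp_polyC addrK comp_polyXr.
have Qy : Q.[y] != 0 by rewrite -rm_shift0 QE.
have Q0 : Q != 0 by apply: contraNneq Qy => ->; rewrite horner0.
pose g := gcdp P Q.
have gP : P %/ g * g = P by apply: divpK; exact: dvdp_gcdl.
have gQ : Q %/ g * g = Q by apply: divpK; exact: dvdp_gcdr.
have Q'0 : Q %/ g != 0 by apply: contraNneq Q0 => E; rewrite -gQ E mul0r.
have g0 : g != 0 by apply: contraNneq Q0 => E; rewrite -gQ E mulr0.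
have cPQ : coprimep (P %/ g) (Q %/ g) by apply: coprimep_div_gcd; rewrite Q0 orbT.
pose r := RatMap Q'0 cPQ.
have rQy : (rm_den r).[y] != 0.
  by apply: contraNneq Qy => /= E; rewrite -gQ hornerM E mul0r.
have s_div (T : {poly R}) : (size T <= k.+1)%N -> (size (T %/ g)%R <= k.+1)%N.
  by move=> sT; rewrite size_divp // (leq_trans (leq_subr _ _)).
have sP : size P = size p by rewrite -PE size_rm_shift.
have sQ : size Q = size q by rewrite -QE size_rm_shift.
exists r; split=> //.
  rewrite /rm_degree /= -ltnS prednK ?ltnS ?geq_max ?s_div ?sP ?sQ //.
  by rewrite leq_max !size_poly_gt0 Q'0 orbT.
have E : (2 * k)%N = (2 * k).-1.+1 by lia.
have H := @jet_ratmap r (2 * k).-1 y rQy; rewrite -E in H.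
have {}H : eqmodX (2 * k).+1 (jet (r : R -> R) (2 * k) y * q) p.
  rewrite -PE -QE -gP -gQ {1}/rm_shift comp_polyM [in X in eqmodX _ _ X]/rm_shift.
  rewrite [in X in eqmodX _ _ X]comp_polyM mulrA.
  by apply: eqmodXM; [exact: H|exact: eqmodX_refl].
move=> j jk; have := eqmodX_mulI q0 (eqmodX_trans H (eqmodX_sym Fq)).
move=> /(_ j jk); rewrite !coef_jet // ?(leq_trans jk) // => /(mulIf _); apply.
by rewrite invr_eq0 pnatr_eq0 -lt0n fact_gt0.
Qed.

Lemma derive1_pade k f y r : (0 < k)%N -> is_pade k f y r ->
  (rm_wronskian r).[y] / (rm_den r).[y] ^+ 2 = f^`()%classic y /\ (r : R -> R) y = f y.
Proof.
move=> k0 [_ Q0 Dr]; split; last by have := Dr 0%N; apply.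
have := Dr 1%N; rewrite !derive1n1 => <-; last by lia.
by rewrite derive1E; have [_ ->] := is_derive_ratmap Q0.
Qed.

(** On a small closed interval around [y] the map is strictly increasing; [h] picks the preimage in
    that interval and defaults to [y] off the image. *)
Lemma local_inverse_exists r y : (rm_den r).[y] != 0 ->
  0 < (rm_wronskian r).[y] -> exists h, is_local_inverse (r : R -> R) y h.
Proof.
move=> Q0 w0.
have : \near y, (rm_den r).[y] != 0 /\ 0 < (rm_wronskian r).[y].
  near=> x; split; near: x.
    by apply: open_nbhs_nbhs; split=> //; exact: open_horner_neq0.
  by apply: (cvgr_gt (rm_wronskian r).[y]) => //; exact: continuous_horner.
move=> /nbhs_ballP [e /= e0 eP].
pose d := e / 2; have d0 : 0 < d by rewrite divr_gt0.
have dP x : y - d <= x <= y + d -> (rm_den r).[x] != 0 /\ 0 < (rm_wronskian r).[x].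
  move=> /andP [x1 x2]; apply: eP; rewrite ball_itv /= in_itv /=.
  by rewrite /d in x1 x2; apply/andP; split; lra.
have Dr x : y - d <= x <= y + d -> is_derive x 1 (r : R -> R)
    ((rm_wronskian r).[x] / (rm_den r).[x] ^+ 2).
  by move=> /dP [Qx _]; exact: is_derive_ratmap.
have incr x1 x2 : y - d <= x1 -> x1 < x2 -> x2 <= y + d -> r x1 < r x2.
  apply: gtr0_derive1_incr.
  - by move=> x xI; have [] := Dr x _; rewrite // !ltW ?(itvP xI).
  - move=> x xI; have xI' : y - d <= x <= y + d by rewrite !ltW ?(itvP xI).
    have [Qx wx] := dP x xI'; rewrite derive1E; have [_ ->] := Dr x xI'.
    by rewrite divr_gt0 // exprn_even_gt0.
  - apply: derivable_within_continuous => x xI.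
    by have [] := Dr x _; rewrite // !(itvP xI).
have inj x1 x2 : y - d <= x1 <= y + d -> y - d <= x2 <= y + d ->
    r x1 = r x2 -> x1 = x2.
  move=> /andP [a1 b1] /andP [a2 b2] E; have [lt|lt|//] := ltgtP x1 x2.
    by have := incr _ _ a1 lt b2; rewrite E ltxx.
  by have := incr _ _ a2 lt b1; rewrite E ltxx.
pose h z := xget y [set x | y - d <= x <= y + d /\ r x = z].
have near_y : \forall x \near y, y - d <= x <= y + d.
  near=> x; have : ball y d x by near: x; exact: nbhsx_ballx.
  by rewrite ball_itv /= in_itv /= => /andP [/ltW -> /ltW ->].
have hr : {near y, cancel (r : R -> R) h}.
  near=> x; have xI : y - d <= x <= y + d by near: x.
  by apply: xget_unique => // x' [x'I]; exact: inj.
exists h; split; first exact: hr.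
apply: near_continuous_can_sym hr.
near=> x; have xI : y - d <= x <= y + d by near: x.
by apply/differentiable_continuous/derivable1_diffP; have [] := Dr x xI.
Unshelve. all: by end_near. Qed.

(** * Value and sign of the Schwarzian derivative *)

Section SchwarzianValue.
Variables (V : set R) (k n : nat) (f : R -> R) (y : R).
Hypotheses (oV : open V) (Vy : V y) (nf : nderivable_on V n f).
Hypotheses (k0 : (0 < k)%N) (kn : (2 * k < n)%N) (f'y : 0 < f^`()%classic y).

Lemma wronskian_pade_gt0 r : is_pade k f y r -> 0 < (rm_wronskian r).[y].
Proof.
move=> pr; have [E _] := derive1_pade k0 pr; have [_ Q0 _] := pr.
have Q2 : 0 < (rm_den r).[y] ^+ 2 by rewrite exprn_even_gt0.
by move: f'y; rewrite -E pmulr_lgt0 // invr_gt0.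
Qed.

(* [u = h \o f] solves [r u = f], so [u' = f' / r'(u)] and the regularity of
   [u] follows inductively from that of [f]. *)
Lemma local_inverse_comp r h : is_pade k f y r -> is_local_inverse (r : R -> R) y h ->
  exists W : set R, [/\ open W, W y, W `<=` V, nderivable_on W n (h \o f) &
    forall x, W x -> (rm_num r).[h (f x)] = f x * (rm_den r).[h (f x)]].
Proof.
move=> pr [hr rh]; have [_ Q0 _] := pr; have [_ ry] := derive1_pade k0 pr.
have w0 := wronskian_pade_gt0 pr.
(* Interiors make each condition hold near every point, as differentiating [h] away from [r y]
   requires. [A1] lives in the source of [r], [A2] in its target, and [W] pulls [A2] back along
   [f]. *)
pose A1 := interior [set x | h ((r : R -> R) x) = x /\
                       (rm_den r).[x] != 0 /\ (rm_wronskian r).[x] != 0].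
have A1y : nbhs y A1.
  apply: nbhs_interior; apply: filterI; first exact: hr.
  apply: filterI; first by apply: open_nbhs_nbhs; split=> //; exact: open_horner_neq0.
  by apply: open_nbhs_nbhs; split=> /=; [exact: open_horner_neq0|rewrite gt_eqF].
have oA1 : open A1 by exact: open_interior.
have A1P x : A1 x -> {near x, cancel (r : R -> R) h} /\
    (\near x, continuous_at x (r : R -> R)).
  move=> A1x; have nA1 : nbhs x A1 by exact: open_nbhs_nbhs.
  split.
    by apply: filterS nA1 => z /interior_subset [].
  apply: filterS nA1 => z /interior_subset [_ [Qz _]].
  apply/differentiable_continuous/derivable1_diffP.
  by have [] := is_derive_ratmap Qz.
have [c1 c2] := A1P y (nbhs_singleton A1y).
have ch : continuous_at ((r : R -> R) y) h.
  exact: (nbhs_singleton (near_can_continuous c1 c2)).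
have hry : h ((r : R -> R) y) = y by exact: (nbhs_singleton hr).
pose A2 := interior [set z | A1 (h z) /\ (r : R -> R) (h z) = z].
have A2y : nbhs ((r : R -> R) y) A2.
  apply: nbhs_interior; apply: filterI; last exact: rh.
  by apply: ch; rewrite hry.
have df x : V x -> derivable f x 1.
  by move=> Vx; apply: (nf (j := 0)) => //; apply: leq_ltn_trans kn.
pose W := interior [set x | V x /\ A2 (f x)].
have Wy : nbhs y W.
  apply: nbhs_interior; apply: filterI; first exact: open_nbhs_nbhs.
  have cf : {for y, continuous f}.
    by apply/differentiable_continuous/derivable1_diffP; exact: df.
  by apply: cf; rewrite -ry.
have oW : open W by exact: open_interior.
have WV : W `<=` V by move=> x /interior_subset [].
have WP x : W x -> A1 (h (f x)) /\ (r : R -> R) (h (f x)) = f x.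
  by move=> /interior_subset [_ /interior_subset].
exists W; split=> //.
- exact: nbhs_singleton.
- have Du x : W x -> is_derive x 1 (h \o f)
      (((rm_den r) ^+ 2).[(h \o f) x] * ((rm_wronskian r).[(h \o f) x])^-1
         * f^`()%classic x).
    move=> Wx; have [A1x rx] := WP x Wx; have [c3 c4] := A1P _ A1x.
    have [_ [Qx wx]] := interior_subset A1x.
    have l0 : (rm_wronskian r).[h (f x)] / (rm_den r).[h (f x)] ^+ 2 != 0.
      by rewrite mulf_neq0 // invr_eq0 expf_neq0.
    have := is_derive_inverse c3 c4 (is_derive_ratmap Qx) l0.
    rewrite rx invfM invrK (mulrC _^-1) => Dh.
    have := is_derive1_comp Dh (is_derive_derive1 (df x (WV x Wx))).
    by rewrite /= horner_exp.
  have nfW : nderivable_on W n f by exact: nderivable_on_sub WV nf.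
  suff H m : (m <= n)%N -> nderivable_on W m (h \o f) by exact: H.
  elim: m => [|m IH] mn; first exact: nderivable_on0.
  have num := IH (ltnW mn).
  apply: (@nderivable_on_is_derive _ _ oW _ _ (fun x =>
      ((rm_den r) ^+ 2).[(h \o f) x] * ((rm_wronskian r).[(h \o f) x])^-1
         * derive1 f x)) => //.
  apply: (nderivable_onM oW).
    apply: (nderivable_onM oW); first exact: (nderivable_on_horner oW).
    apply: (nderivable_onV oW); last exact: (nderivable_on_horner oW).
    by move=> x Wx; have [/interior_subset [_ []]] := WP x Wx.
  by have [] := nderivable_onS (nderivable_on_le mn nfW).
move=> x Wx; have [A1x rx] := WP x Wx.
have [_ [Qx _]] := interior_subset A1x.
by apply: (mulIf (invr_neq0 Qx)); rewrite mulfK //; exact: rx.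
Qed.

(** [u = h \o f] solves [P(u) = f Q(u)] and fixes [y], so [pade_error_inverse] applies to its
    recentred jet; the factorial converts a Taylor coefficient into a derivative. *)
Lemma schwarzian_value r h : is_pade k f y r -> is_local_inverse (r : R -> R) y h ->
  let p := rm_shift y (rm_num r) in let q := rm_shift y (rm_den r) in
  derive1n (2 * k).+1 (h \o f) y * (f^`()%classic y * q`_0)
  = (2 * k).+1`!%:R * (jet f n y * q - p)`_(2 * k).+1.
Proof.
move=> pr hinv p q; have [_ ry] := derive1_pade k0 pr.
have [sp sq q0 Fq] := pade_shift k0 (ltnW kn) pr.
have [W [oW Wy WV nu uP]] := local_inverse_comp pr hinv.
set u := h \o f in nu *; have nfW := nderivable_on_sub WV nf.
pose U := jet u n y.
have hy : u y = y.
  by rewrite /u /= -ry; exact: (nbhs_singleton hinv.1).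
have PQ : eqmodX (2 * k).+2 (p \Po (U - y%:P)) (jet f n y * (q \Po (U - y%:P))).
  have sh P : rm_shift y P \Po (U - y%:P) = P \Po U.
    rewrite /rm_shift -comp_polyA; congr (_ \Po _).
    by rewrite comp_polyD comp_polyX comp_polyC subrK.
  rewrite !sh; apply: (@eqmodX_le _ n.+1); first by rewrite ltnS.
  apply: (eqmodX_trans (eqmodX_sym (jet_horner _ oW Wy nu))).
  rewrite (@eq_jet _ W _ (fun x => f x * (rm_den r).[u x]) _ _ oW Wy) //.
  apply: (eqmodX_trans (jetM oW Wy nfW (nderivable_on_horner oW nu))).
  by apply: eqmodXM; [exact: eqmodX_refl|exact: (jet_horner _ oW Wy nu)].
have F1 : (jet f n y)`_1 = f^`()%classic y.
  by rewrite coef_jet ?divr1 //; apply: leq_ltn_trans kn.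
have U0 : (U - y%:P)`_0 = 0 by rewrite coefB coefC jet0 hy subrr.
have := pade_error_inverse k0 sp Fq q0 _ U0 PQ.
rewrite F1 gt_eqF // => /(_ isT) <-.
by rewrite coefB coefC subr0 coef_jet // [RHS]mulrA [X in _ = X * _]mulrC divfK //.
Qed.

(** [schwarzian_value] times the constant term of the shifted denominator: the other factors are
    [f'(y)], a square and a factorial, all positive. The sign is thus unaffected by rescaling the
    fraction. *)
Lemma is_schwarzian_sign s : is_schwarzian k f y s ->
  exists2 r, is_pade k f y r &
    (0 <= s) = (0 <= (rm_shift y (rm_den r))`_0 *
      (jet f n y * rm_shift y (rm_den r) - rm_shift y (rm_num r))`_(2 * k).+1).
Proof.
move=> [r [h [pr hinv ->]]]; exists r => //.
have [_ _ q0 _] := pade_shift k0 (ltnW kn) pr.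
have E := schwarzian_value pr hinv; cbv zeta in E.
have H1 : 0 < f^`()%classic y * (rm_shift y (rm_den r))`_0 ^+ 2.
  by rewrite mulr_gt0 // exprn_even_gt0.
have H2 : 0 < (2 * k).+1`!%:R :> R by rewrite ltr0n fact_gt0.
rewrite -[LHS](pmulr_lge0 _ H1) -[RHS](pmulr_rge0 _ H2); congr (0 <= _).
by rewrite [RHS]mulrCA -E; ring.
Qed.

End SchwarzianValue.
End RationalMaps.

Theorem lemma10 (R : realType) (d : nat) (U : set R) (f : R -> R)
    (d_gt0 : (0 < d)%N) (openU : open U) (itvU : is_interval U)
    (fD : nderivable_on U (2 * d).+1 f)
    (Df_gt0 : forall x : R, U x -> 0 < f^`() x) :
  (forall k : nat, (1 <= k <= d)%N -> forall x : R, U x ->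
     schwarzian_exists k f x /\ 0 <= schwarzian k f x)
  <-> mx_monotone U d.+1 f.
Proof.
have Ed : (2 * d.+1).-1 = (2 * d).+1 by lia.
split=> [Sk|mono].
  apply: mx_monotone_of_hankel => //; rewrite ?Ed // => x Ux.
  suff H k : (k <= d)%N -> hankel_psd (jet f (2 * d).+1 x) k.+1 by exact: H.
  elim: k => [|k IH] kd.
    (* The form of size one is [f'(x)] times the square of a constant. *)
    move=> p sp; rewrite (size1_polyC sp) -polyC_exp coefCM mulr_ge0 ?sqr_ge0 //.
    by rewrite coef_jet // divr1; exact/ltW/Df_gt0.
  have k0 : (0 < k.+1)%N by []; have kn : (2 * k.+1 < (2 * d).+1)%N by lia.
  have [[r0 pr0] S0] := Sk k.+1 kd x Ux.
  have [h hP] : exists h, is_local_inverse (r0 : R -> R) x h.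
    apply: local_inverse_exists; first by case: pr0.
    exact: (wronskian_pade_gt0 k0 (Df_gt0 x Ux) pr0).
  (* A witness exists, so the hypothesis concerns the true derivative and not the default [0]. *)
  have : is_schwarzian k.+1 f x (schwarzian k.+1 f x).
    apply: (@xgetPex _ 0 [set s | is_schwarzian k.+1 f x s]).
    by exists ((h \o f)^`((2 * k.+1).+1) x), r0, h.
  move=> /(is_schwarzian_sign openU Ux fD k0 kn (Df_gt0 x Ux)) [r pr E].
  have [sp sq q0 Fq] := pade_shift k0 (ltnW kn) pr.
  apply: (hankel_psd_step sp sq Fq q0); first by rewrite -E.
  exact: IH (ltnW kd).
move=> k /andP [k0 kd] x Ux.
have kn : (2 * k < (2 * d).+1)%N by lia.
have hF : hankel_psd (jet f (2 * d).+1 x) k.+1.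
  have nfd : nderivable_on U (2 * d.+1).-1 f by rewrite Ed.
  have := hankel_of_mx_monotone openU nfd mono Ux; rewrite Ed.
  exact: hankel_psd_le.
split.
  have [q [sq q0 qP]] := pade_denominator_exists k0 hF.
  (* The coefficients of [F q] of index [k.+1] to [2 * k] vanish, so cutting at degree [k] loses
     nothing modulo ['X^(2k+1)]. *)
  pose p := take_poly k.+1 (jet f (2 * d).+1 x * q).
  apply: (pade_of_pair k0 (ltnW kn) (_ : (size p <= _)%N) sq q0).
    exact: size_take_poly.
  move=> i ik; rewrite coef_take_poly; case: ifP => // /negbT; rewrite -leqNgt => ki.
  by rewrite qP.
(* The default [0] satisfies the bound; any other value has the sign of the Hankel form at the
   shifted denominator. *)
rewrite /schwarzian; case: xgetP => [s -> /= hs|//].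
have [r pr ->] := is_schwarzian_sign openU Ux fD k0 kn (Df_gt0 x Ux) hs.
have [sp sq q0 Fq] := pade_shift k0 (ltnW kn) pr.
have := hF _ sq; rewrite (_ : (2 * k.+1).-1 = (2 * k).+1); last by lia.
by rewrite (pade_hankel_den sp sq Fq).
Qed.
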